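(* Let $k,\alpha>0$, $\gamma,\omega\in\mathbb{R}$, $\mu\in(0,1)$ with $\mu<k$, and $\nu\in[0,1]$. Let $f$ be a function on $[0,\infty)$ with $f\in L^1[0,b]$ and ${}_{k}P_{\alpha,(1-\nu)(k-\mu),\omega,0^{+}}^{-\gamma(1-\nu)}f\in AC^{1}[0,b]$ for every $b>0$, such that the Sumudu transforms of $f$ and of the $k$-Hilfer-Prabhakar derivative ${}_{k}\mathcal{D}_{\alpha,\omega,0^{+}}^{\gamma,\mu,\nu}f$ exist, and let $F(u)=\mathcal{S}[f](u)$. Then, for $u>0$ with $\left|\omega k\left(\frac uk\right)^{\alpha/k}\right|<1$, $$\mathcal{S}\big({}_{k}\mathcal{D}_{\alpha,\omega,0^{+}}^{\gamma,\mu,\nu}f(t)\big)(u)=\Big(\frac{u}{k}\Big)^{-\frac{\mu}{k}}\Big(1-\omega k\Big(\frac{u}{k}\Big)^{\frac{\alpha}{k}}\Big)^{\frac{\gamma}{k}}F(u)-\Big(\frac{u}{k}\Big)^{\frac{\nu(k-\mu)}{k}-1}\Big(1-\omega k\Big(\frac{u}{k}\Big)^{\frac{\alpha}{k}}\Big)^{\frac{\gamma\nu}{k}}\Big[{}_{k}P_{\alpha,(1-\nu)(k-\mu),\omega,0^{+}}^{-\gamma(1-\nu)}f(t)\Big]_{t=0^{+}}.$$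
   Context: The Sumudu transform is $\mathcal{S}[f](u)=\int_0^\infty\frac1u e^{-t/u}f(t)\,dt$, considered for functions $f$ in the set $A$ of functions for which there are $M,\tau_1,\tau_2>0$ with $|f(t)|\le Me^{|t|/\tau_j}$ for $t\in(-1)^j\times[0,\infty)$, and $u\in(-\tau_1,\tau_2)$; here $u>0$. $AC^{1}[0,b]$ is the set of real-valued absolutely continuous functions on $[0,b]$. The $k$-gamma function is $\Gamma_k(z)=\int_0^\infty e^{-t^k/k}t^{z-1}\,dt$ for $\operatorname{Re}z>0$, and the $k$-Pochhammer symbol is $(\gamma)_{n,k}=\gamma(\gamma+k)\cdots(\gamma+(n-1)k)$, $(\gamma)_{0,k}=1$. The $k$-Mittag-Leffler function is $E_{k,\alpha,\mu}^{\gamma}(z)=\sum_{n=0}^\infty \frac{(\gamma)_{n,k}}{\Gamma_k(\alpha n+\mu)}\frac{z^n}{n!}$. The $k$-Prabhakar integral (for $\operatorname{Re}\alpha,\operatorname{Re}\mu>0$) is $$\big({}_{k}P_{\alpha,\mu,\omega}^{\gamma}f\big)(x)=\big({}_{k}P_{\alpha,\mu,\omega,0^+}^{\gamma}f\big)(x)=\int_0^x\frac{(x-t)^{\frac{\mu}{k}-1}}{k}E_{k,\alpha,\mu}^{\gamma}\big[\omega(x-t)^{\frac{\alpha}{k}}\big]f(t)\,dt ,$$ with the convention that ${}_{k}P_{\alpha,0,\omega}^{0}$ is the identity. The $k$-Hilfer-Prabhakar fractional derivative is $${}_{k}\mathcal{D}_{\alpha,\omega,0^{+}}^{\gamma,\mu,\nu}f(t)=k\Big({}_{k}P_{\alpha,\nu(k-\mu),\omega,0^{+}}^{-\gamma\nu}\frac{d}{dt}\big({}_{k}P_{\alpha,(1-\nu)(k-\mu),\omega,0^{+}}^{-\gamma(1-\nu)}f\big)\Big)(t).$$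 *)

(* Defs.v *)
From mathcomp Require Import all_boot all_order all_algebra.
From mathcomp Require Import all_classical all_reals all_analysis.
From mathcomp Require Import measurable_realfun.
Import Order.TTheory GRing.Theory Num.Theory numFieldNormedType.Exports.

Set Implicit Arguments.
Unset Strict Implicit.
Unset Printing Implicit Defensive.

Local Open Scope classical_set_scope.
Local Open Scope ring_scope.

Section kHilferPrabhakar.
Context {R : realType}.
Implicit Types (f g : R -> R) (a b k alpha mu nu gam omega u x z : R).

Local Notation leb := (@lebesgue_measure R).

Definition kpochhammer k gam (n : nat) : R := \prod_(i < n) (gam + i%:R * k).

Definition kGamma k z : R :=
  \int[leb]_(t in `[0, +oo[) (expR (- (t `^ k / k)) * t `^ (z - 1)).

Definition kMittagLeffler k alpha mu gam z : R :=
  limn (series (fun n : nat =>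
    kpochhammer k gam n / kGamma k (alpha * n%:R + mu) * (z ^+ n / n`!%:R))).

(* An order [mu = 0] only occurs together with [gam = 0]; the operator is then
   the identity by convention. *)
Definition kPrabhakar k alpha mu omega gam f : R -> R := fun x =>
  if (mu == 0) && (gam == 0) then f x
  else \int[leb]_(t in `[0, x])
    ((x - t) `^ (mu / k - 1) / k
     * kMittagLeffler k alpha mu gam (omega * (x - t) `^ (alpha / k)) * f t).

Definition kHilferPrabhakar k alpha omega gam mu nu f : R -> R := fun t =>
  k * kPrabhakar k alpha (nu * (k - mu)) omega (- (gam * nu))
        (derive1 (kPrabhakar k alpha ((1 - nu) * (k - mu)) omega
                    (- (gam * (1 - nu))) f)) t.

Definition abs_cont a b g :=
  forall e : R, 0 < e -> exists2 d : R, 0 < d &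
    forall (n : nat) (l r : 'I_n -> R),
      (forall i, a <= l i /\ l i <= r i /\ r i <= b) ->
      trivIset [set: 'I_n] (fun i => `]l i, r i[%classic) ->
      \sum_(i < n) (r i - l i) < d ->
      \sum_(i < n) `|g (r i) - g (l i)| < e.

(* Membership in AC[0, b] for a function produced by an integral over [0, x]:
   such an integral is 0 at x = 0 whatever its right limit there, so the value
   at 0 is disregarded; the absolutely continuous function agreeing with [g] on
   ]0, b] has the value g(0+) at 0.  Requiring [abs_cont 0 b g] instead would
   force g(0+) = 0. *)
Definition AC0 b g :=
  exists2 h : R -> R, abs_cont 0 b h & forall x, 0 < x <= b -> h x = g x.

Definition sumudu f u : R :=
  \int[leb]_(t in `[0, +oo[) (u^-1 * expR (- (t / u)) * f t).

Definition ex_sumudu f u : Prop :=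
  leb.-integrable `[0, +oo[
    (EFin \o (fun t => u^-1 * expR (- (t / u)) * f t)).

(* Absolute convergence at the given u is implied by the usual requirement of
   growth at most M e^(t/tau) with u < tau, and unlike it allows an integrable
   singularity at 0. *)
Lemma ex_sumudu_growth f (M tau u : R) :
  measurable_fun (`[0, +oo[%classic : set R) f ->
  (forall t, 0 <= t -> `|f t| <= M * expR (t / tau)) ->
  0 < u < tau -> ex_sumudu f u.
Proof.
move=> mf fM /andP[u0 utau].
have tau0 : 0 < tau := lt_trans u0 utau.
pose r := u^-1 - tau^-1.
have r0 : 0 < r by rewrite subr_gt0 ltf_pV2.
have iE : leb.-integrable `[0, +oo[
    (fun t => ((u^-1 * M / r)%:E * (EFin \o exponential_pdf r) t)%E).
  apply: integrableZl => //.
  apply: (@integrableS _ _ _ _ setT) => //.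
  by apply: integrable_exponential_pdf; rewrite ?ltW.
apply: le_integrable iE => //.
- apply/measurable_EFinP; apply: measurable_funM => //.
  apply: measurable_funM => //; apply: measurable_funTS.
  apply: measurableT_comp => //.
  by apply: measurableT_comp => //; apply: measurable_funM.
- move=> t /=; rewrite in_itv/= andbT => t0.
  rewrite lee_fin exponential_pdfE// mulrA divfK ?gt_eqF//.
  apply: le_trans (ler_norm _).
  rewrite !normrM (gtr0_norm (expR_gt0 _)) gtr0_norm ?invr_gt0//.
  rewrite -mulrA -[leRHS]mulrA ler_pM2l ?invr_gt0//.
  have -> : - r * t = t / tau - t / u by rewrite /r opprB mulrBl ![_^-1 * t]mulrC.
  rewrite expRD mulrA [leRHS]mulrC ler_pM2l ?expR_gt0//.
  exact: fM.
Qed.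

End kHilferPrabhakar.

(* Main.v *)
From HB Require Import structures.
Require Import Defs.
From mathcomp Require Import all_boot all_order all_algebra.
From mathcomp Require Import all_classical all_reals all_analysis.
From mathcomp Require Import measurable_realfun ring lra.
Import Order.TTheory GRing.Theory Num.Theory numFieldNormedType.Exports.

Local Open Scope classical_set_scope.
Local Open Scope ring_scope.

Set Implicit Arguments.
Unset Strict Implicit.
Unset Printing Implicit Defensive.

(** Write [L f] for the integral of [exp (- t / u) * f t] over [0, oo[; the
    Sumudu transform is [L f / u].  For an order [a > 0] the k-Prabhakar
    integral is a convolution with the kernel
      [K_a t = t^(a/k - 1) / k * E (omega * t^(alpha/k))],
    where [E] is a Mittag-Leffler function with an upper parameter [g], and for
    order 0 it is the identity.  Two facts carry the proof.

    First, [L K_a = (u/k)^(a/k) * (1 - x)^(- g/k)] for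
    [x = omega k (u/k)^(alpha/k)] ([laplace_kPrabhakar_kernel]).  The
    substitution [t = (u/k) s^k] shows that the Laplace integral of
    [t^(z/k - 1) / k] is [(u/k)^(z/k) * Gamma_k z], so that integrating the
    Mittag-Leffler series term by term cancels its gamma factors and leaves the
    binomial series of [(1 - x)^(- g/k)], absolutely convergent for [|x| < 1].
    With the convolution theorem [laplace_convol] this gives the transform of
    the inner operator [G = P f].

    Second, the outer operator is applied to [G'], and nothing says that
    [exp (- t / u) * G' t] is integrable: the existence of a transform is assumed
    only for [D = K_b * G'].  The primitive of [D] is however
    [1 * D = K_b * (1 * G') = K_b * (G - G(0+))] ([convol_primitive]), where
    both sides are convolutions of functions that do have a transform at [u].
    Hence [u * L D = L K_b * (L G - u * G(0+))]
    ([laplace_kPrabhakar_derive1]), and the theorem follows by collecting the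
    powers of [u/k] and of [1 - x].

    The identity [1 * G' = G - G(0+)] is the fundamental theorem of calculus for
    absolutely continuous functions ([AC0_derivative]).  An absolutely continuous
    function is a difference of two monotone ones, given by its total variation;
    the Stieltjes measure of a monotone absolutely continuous function vanishes
    on null sets, so it has a density by Radon-Nikodym, and the Lebesgue
    differentiation theorem identifies the density with the derivative almost
    everywhere.  As [G'] is defined pointwise, with a default value where [G]
    is not differentiable, it is replaced by the density under integrals by means
    of [integral_off_null], which covers functions that may not be measurable. *)

(** * Integrals and null sets *)

Section ae_integral.
Context d (T : measurableType d) (R : realType) (mu : {measure set T -> \bar R}).
Local Open Scope ereal_scope.
Import HBNNSimple.

(** The integral of a nonnegative function is a supremum over the simple
    functions below it, and cutting a simple function off on a null set does
    not change its integral. *)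
Lemma ge0_le_integral_off_null (N : set T) (f g : T -> \bar R) :
  measurable N -> mu N = 0 ->
  (forall x, 0 <= f x) -> (forall x, 0 <= g x) ->
  (forall x, ~ N x -> f x <= g x) ->
  \int[mu]_x f x <= \int[mu]_x g x.
Proof.
move=> mN N0 f0 g0 fg; rewrite !ge0_integralTE//.
apply: ge_ereal_sup => _ [h /= hf <-].
have mNC : measurable (~` N) by exact: measurableC.
apply: ereal_sup_ubound => /=; exists (proj_nnsfun h mNC).
  move=> x /=; rewrite /= mindicE.
  have [xN|xN] := boolP (x \in ~` N).
    by rewrite mulr1 (le_trans (hf x))// fg//; rewrite inE in xN.
  by rewrite mulr0 g0.
rewrite -!integralT_nnsfun; apply: ge0_ae_eq_integral => //.
- exact/measurable_EFinP.
- exact/measurable_EFinP.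
- by move=> x _; rewrite lee_fin.
- by move=> x _; rewrite lee_fin.
exists N; split => // x /=; apply: contra_notP => Nx _.
by rewrite mindicE mem_set ?mulr1.
Qed.

(** This serves for derivatives taken pointwise, which carry a default value
    where they do not exist and may fail to be measurable. *)
Lemma integral_off_null (N D : set T) (f g : T -> \bar R) :
  measurable N -> mu N = 0 -> (forall x, D x -> ~ N x -> f x = g x) ->
  \int[mu]_(x in D) f x = \int[mu]_(x in D) g x.
Proof.
move=> mN N0 fg; rewrite integral_mkcond [RHS]integral_mkcond.
rewrite integralE [RHS]integralE.
have fgD x : ~ N x -> (f \_ D) x = (g \_ D) x.
  by move=> Nx; rewrite !patchE; case: ifPn => // /set_mem Dx; exact: fg.
congr (_ - _); apply/eqP; rewrite eq_le; apply/andP; split;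
  apply: (ge0_le_integral_off_null mN N0) => // x Nx;
  by rewrite ?funeposE ?funenegE fgD.
Qed.

Lemma Rintegral_off_null (N D : set T) (f g : T -> R) :
  measurable N -> mu N = 0 -> (forall x, D x -> ~ N x -> f x = g x) ->
  (\int[mu]_(x in D) f x = \int[mu]_(x in D) g x)%R.
Proof.
move=> mN N0 fg; congr fine; apply: (integral_off_null mN N0) => x Dx Nx.
by rewrite fg.
Qed.

End ae_integral.

(** * Reflections and translations *)

Section reflection.
Context {R : realType}.
Local Notation L := (@lebesgue_measure R).
Local Open Scope ereal_scope.

Lemma measurable_reflect (c : R) : measurable_fun [set: R] (fun x : R => c - x)%R.
Proof. exact: measurable_funB. Qed.

Lemma lebesgue_measure_reflect (c : R) (A : set R) : measurable A ->
  pushforward L (fun x : R => c - x : measurableTypeR R)%R A = L A.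
Proof.
move=> mA; have mr := measurable_reflect c.
apply/esym/(@lebesgue_measure_unique R
  (pushforward L (fun x : R => c - x : measurableTypeR R)%R :
     {measure set _ -> \bar R})) => //=.
move=> _ [[a b]] _ <-; rewrite /pushforward /=.
rewrite (_ : _ @^-1` _ = `[(c - b)%R, (c - a)%R[%classic); last first.
  apply/seteqP; split => x /=; rewrite !in_itv/= => /andP[h1 h2];
    apply/andP; split; lra.
by rewrite !lebesgue_measure_itv/= !lte_fin ltrD2l ltrN2 -!EFinB; case: ifPn => // _;
  congr (_%:E); ring.
Qed.

Lemma ge0_integral_reflect (c : R) (D : set R) (f : R -> \bar R) :
  measurable D -> measurable_fun D f -> (forall x, 0 <= f x) ->
  \int[L]_(x in [set x | D (c - x)%R]) f (c - x)%R = \int[L]_(x in D) f x.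
Proof.
move=> mD mf f0; have mr := measurable_reflect c.
rewrite -[LHS](@ge0_integral_pushforward _ _
  (measurableTypeR R) (measurableTypeR R) R
  (fun x : R => c - x : measurableTypeR R)%R mr L D f)//.
by apply: eq_measure_integral => //= A mA AD; exact: lebesgue_measure_reflect.
Qed.

Lemma integral_reflect (c : R) (D : set R) (f : R -> \bar R) :
  measurable D -> measurable_fun D f ->
  \int[L]_(x in [set x | D (c - x)%R]) f (c - x)%R = \int[L]_(x in D) f x.
Proof.
move=> mD mf; rewrite integralE [RHS]integralE; congr (_ - _).
  rewrite -(ge0_integral_reflect c mD)//; last exact: measurable_funepos.
  by apply: eq_integral => x _; rewrite !funeposE.
rewrite -(ge0_integral_reflect c mD)//; last exact: measurable_funeneg.
by apply: eq_integral => x _; rewrite !funenegE.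
Qed.

(** A translation is a composition of two reflections. *)
Lemma integral_translate (t : R) (D : set R) (f : R -> \bar R) :
  measurable D -> measurable_fun D f ->
  \int[L]_(x in [set x | D (x - t)%R]) f (x - t)%R = \int[L]_(x in D) f x.
Proof.
move=> mD mf; rewrite -(integral_reflect 0 mD mf).
rewrite -(@integral_reflect t [set x | D (0 - x)%R] (fun x => f (0 - x)%R)).
- by under [RHS]eq_integral do rewrite sub0r opprB;
    congr integral; apply/seteqP; split => x /=; rewrite sub0r opprB.
- by rewrite -[X in measurable X]setTI; exact: measurable_reflect.
- apply: (@measurable_comp _ _ _ _ _ _ D) => //.
    by move=> _ [x /= Dx <-].
  by apply: measurable_funTS; exact: measurable_reflect.
Qed.

End reflection.

(** * Convolution on the line *)

Section convolution.
Context {R : realType}.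
Local Notation L := (@lebesgue_measure R).
Variables f g : R -> R.
Hypotheses (fL : L.-integrable setT (EFin \o f)) (gL : L.-integrable setT (EFin \o g)).

Let mf : measurable_fun setT f.
Proof. by apply/measurable_EFinP; apply: measurable_int fL. Qed.

Let mg : measurable_fun setT g.
Proof. by apply/measurable_EFinP; apply: measurable_int gL. Qed.

Let mabs (k : R -> R) : measurable_fun setT k ->
  measurable_fun setT (fun x => `|(k x)%:E|)%E.
Proof.
move=> mk; have mEk : measurable_fun setT (EFin \o k) by exact/measurable_EFinP.
exact: (measurableT_comp (f := abse) _ mEk).
Qed.

Let h (z : R * R) : \bar R := (f (z.1 - z.2) * g z.2)%:E.

Let mh : measurable_fun setT h.
Proof.
apply/measurable_EFinP; apply: measurable_funM.
  apply: (measurableT_comp mf); apply: measurable_funB.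
    exact: measurable_fst.
  exact: measurable_snd.
apply: (measurableT_comp mg); exact: measurable_snd.
Qed.

Let translated_integrable (t : R) :
  L.-integrable setT (EFin \o (fun x => f (x - t))).
Proof.
have mt : measurable_fun setT (fun x : R => x - t) by exact: measurable_funB.
apply/integrableP; split.
  exact/measurable_EFinP/measurableT_comp.
have := @integral_translate R t setT (fun x => `|(f x)%:E|)%E measurableT.
have -> : [set x | setT (x - t)] = [set: R] by apply/seteqP; split.
move=> -> /=; last exact: mabs.
by case/integrableP : fL.
Qed.

(* In the inner integral of Tonelli's formula, taken in x, the translation by y
   can be undone, so the double integral is a product. *)
Let h_integrable : (L \x L)%E.-integrable setT h.
Proof.
apply/integrable21ltyP => //.
have -> : (\int[L]_y \int[L]_x `|h (x, y)|)%E =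
          (\int[L]_y (`|(g y)%:E| * \int[L]_x `|(f x)%:E|))%E.
  apply: eq_integral => y _; rewrite -ge0_integralZl//; last exact: mabs.
  have := @integral_translate R y setT (fun x => `|(g y)%:E| * `|(f x)%:E|)%E measurableT.
  have -> : [set x | setT (x - y)] = [set: R] by apply/seteqP; split.
  move=> <- /=; last by apply: measurable_funeM; exact: mabs.
  by apply: eq_integral => x _; rewrite /h/= normrM EFinM muleC.
rewrite ge0_integralZr//.
- apply: lte_mul_pinfty => //; first exact: integral_ge0.
    by rewrite ge0_fin_numE ?integral_ge0//; case/integrableP: gL.
  by case/integrableP: fL.
- exact: mabs.
- exact: integral_ge0.
Qed.

Let F (x : R) : \bar R := (\int[L]_t h (x, t))%E.

Let F_integrable : L.-integrable setT F.
Proof. exact: integrable_fubini_F h_integrable. Qed.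

Lemma convolution_integrable (D : set R) : measurable D ->
  L.-integrable D (EFin \o (fun x => \int[L]_t (f (x - t) * g t))).
Proof.
move=> mD; apply: (@integrableS _ _ _ L setT) => //.
apply: (le_integrable measurableT _ _ F_integrable) => [|x _].
  apply/measurable_EFinP; apply: (measurableT_comp (f := fine)) => //.
  exact: measurable_int F_integrable.
have : (`|(fine (F x))%:E| <= `|F x|)%E by case: (F x) => [r||]; rewrite /= ?normr0 ?leey.
by [].
Qed.

(** Fubini's theorem, with the integration over [D] carried out first. *)
Lemma integral_convolution (D : set R) : measurable D ->
  \int[L]_(x in D) (\int[L]_t (f (x - t) * g t)) =
  \int[L]_t (g t * \int[L]_(x in D) f (x - t)).
Proof.
move=> mD; congr fine.
transitivity (\int[L]_(x in D) F x)%E.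
  have [N [mN N0 NF]] := integrable_ae measurableT F_integrable.
  apply: (integral_off_null mN N0) => x Dx Nx.
  rewrite /Rintegral -/(F x) fineK//; apply: contrapT => Fx.
  by apply: Nx; apply: NF => /= /(_ I).
pose h' := h \_ (D `*` setT).
have h'L : (L \x L)%E.-integrable setT h'.
  rewrite -integrable_mkcond; last exact: measurableX.
  by apply: integrableS h_integrable => //; exact: measurableX.
transitivity (\int[L]_x \int[L]_t h' (x, t))%E.
  rewrite integral_mkcond; apply: eq_integral => x _; rewrite patchE.
  case: ifPn => xD.
    apply: eq_integral => t _; rewrite /h' patchE mem_set//=; split => //.
    exact: set_mem.
  rewrite integral0_eq// => t _; rewrite /h' patchE memNset//= => -[/= Dx _].
  by move: xD; rewrite notin_setE.
rewrite Fubini//; apply: eq_integral => t _.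
transitivity (\int[L]_(x in D) h (x, t))%E.
  rewrite [RHS]integral_mkcond; apply: eq_integral => x _; rewrite /h' !patchE.
  case: ifPn => [/set_mem[/= Dx _]|]; first by rewrite mem_set.
  rewrite notin_setE/= => nD; rewrite memNset// => Dx; exact: nD.
have fD : L.-integrable D (EFin \o (fun x => f (x - t))).
  by apply: integrableS (translated_integrable t).
rewrite EFinM /Rintegral fineK; last exact: integrable_fin_num.
rewrite -integralZl//; apply: eq_integral => x _.
by rewrite /h/= mulrC EFinM.
Qed.

End convolution.

(** * Truncated convolution and the Laplace integral *)

Section truncated_convolution.
Context {R : realType}.
Local Notation L := (@lebesgue_measure R).
Local Notation Rp := (`[0, +oo[%classic : set R).
Implicit Types (f g : R -> R) (x : R).

(** Meant for the points where a convolution integral diverges, which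
    [RintegralZl] does not cover. *)
Lemma Rintegral_gt0Zl (D : set R) f (c : R) : measurable D ->
  measurable_fun D f -> 0 < c ->
  \int[L]_(x in D) (c * f x) = c * \int[L]_(x in D) f x.
Proof.
move=> mD mf c0; rewrite /Rintegral integralE [in RHS]integralE.
have mEf : measurable_fun D (EFin \o f) by exact/measurable_EFinP.
have -> : (\int[L]_(x in D) (fun x => (c * f x)%:E)^\+ x =
           c%:E * \int[L]_(x in D) (EFin \o f)^\+ x)%E.
  rewrite -ge0_integralZl_EFin//; last 2 first.
  - exact: measurable_funepos.
  - exact: ltW.
  by apply: eq_integral => x _; rewrite !funeposE/= EFinM maxe_pMr ?mule0 ?ltW.
have -> : (\int[L]_(x in D) (fun x => (c * f x)%:E)^\- x =
           c%:E * \int[L]_(x in D) (EFin \o f)^\- x)%E.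
  rewrite -ge0_integralZl_EFin//; last 2 first.
  - exact: measurable_funeneg.
  - exact: ltW.
  by apply: eq_integral => x _; rewrite !funenegE/= -mulrN EFinM maxe_pMr ?mule0 ?ltW.
case: (\int[L]_(x in D) _)%E => [a||]; case: (\int[L]_(x in D) _)%E => [b||];
  rewrite ?gt0_muley ?gt0_muleNy ?lte_fin//= ?mulr0 //; ring.
Qed.

Definition convol f g (x : R) : R := \int[L]_(t in `[0, x]) (f (x - t) * g t).

Lemma convolE f g x :
  \int[L]_t ((f \_ Rp) (x - t) * (g \_ Rp) t) = convol f g x.
Proof.
rewrite /convol [RHS]Rintegral_mkcond; apply: eq_Rintegral => t _.
rewrite !patchE !mem_setE !in_itv/= !andbT subr_ge0.
by case: (leP 0 t) => //= _; case: (leP t x) => //= _; rewrite ?(mul0r, mulr0).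
Qed.

Lemma measurable_convol_integrand f g x :
  measurable_fun `[0, x] f -> measurable_fun `[0, x] g ->
  measurable_fun `[0, x] (fun t => f (x - t) * g t).
Proof.
move=> mf mg; apply: measurable_funM => //.
apply: (@measurable_comp _ _ _ _ _ _ `[0, x]%classic) => //.
  by move=> _ [t /= + <-]; rewrite !in_itv/= => /andP[? ?]; apply/andP; split; lra.
by apply: measurable_funTS; exact: measurable_reflect.
Qed.

Lemma convolC f g x :
  measurable_fun `[0, x] f -> measurable_fun `[0, x] g ->
  convol f g x = convol g f x.
Proof.
move=> mf mg; rewrite /convol /Rintegral -(@integral_reflect R x)//; last first.
  by apply/measurable_EFinP; apply: measurable_convol_integrand.
congr fine; rewrite (_ : [set t | _] = `[0, x]%classic).
  by apply: eq_integral => t _; rewrite opprB addrCA subrr addr0 mulrC.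
by apply/seteqP; split => t /=; rewrite !in_itv/= => /andP[? ?]; apply/andP; split; lra.
Qed.

(** This is associativity of convolution, one of the three factors being the
    constant function 1. *)
Lemma convol_primitive f g (X : R) :
  L.-integrable `[0, X] (EFin \o f) -> L.-integrable `[0, X] (EFin \o g) ->
  \int[L]_(x in `[0, X]) convol g f x =
    convol (fun y => \int[L]_(x in `[0, y]) g x) f X.
Proof.
move=> fX gX.
pose f1 := f \_ `[0, X]; pose g1 := g \_ `[0, X].
have f1L : L.-integrable setT (EFin \o f1).
  by rewrite -restrict_EFin; apply/integrable_restrict => //; rewrite setTI.
have g1L : L.-integrable setT (EFin \o g1).
  by rewrite -restrict_EFin; apply/integrable_restrict => //; rewrite setTI.
have cE x : x \in `[0, X]%classic -> convol g f x = \int[L]_t (g1 (x - t) * f1 t).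
  rewrite inE/= in_itv/= => /andP[x0 xX].
  rewrite /convol Rintegral_mkcond; apply: eq_Rintegral => t _.
  rewrite /f1 /g1 !patchE !mem_setE !in_itv/= subr_ge0.
  have [t0|t0] := leP 0 t; rewrite /= ?mulr0//.
  have [tx|tx] := leP t x; rewrite /= ?mul0r//.
  by rewrite (le_trans tx xX) (_ : x - t <= X)//; lra.
transitivity (\int[L]_(x in `[0, X]) (\int[L]_t (g1 (x - t) * f1 t))).
  exact: eq_Rintegral.
rewrite (integral_convolution g1L f1L)//.
rewrite /convol [RHS]Rintegral_mkcond; apply: eq_Rintegral => t _.
rewrite /f1 !patchE; case: ifPn => [|_]; last by rewrite mul0r.
rewrite inE/= in_itv/= => /andP[t0 tX]; rewrite mulrC; congr (_ * _); congr fine.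
rewrite (_ : `[0, X]%classic = [set x | `[- t, X - t]%classic (x - t)]); last first.
  by apply/seteqP; split => x /=; rewrite !in_itv/= => /andP[? ?]; apply/andP; split; lra.
rewrite (@integral_translate R t _ (EFin \o g1))//; last first.
  by apply: measurable_funTS; exact: measurable_int g1L.
rewrite [LHS]integral_mkcond [RHS]integral_mkcond; apply: eq_integral => x _.
rewrite !patchE /= /g1 patchE !mem_setE !in_itv/=.
have [x0|x0] := leP 0 x => /=; last by case: ifP.
have -> /= : - t <= x by apply: le_trans x0; rewrite oppr_le0.
case: (leP x (X - t)) => //= xXt.
by have -> : x <= X by rewrite (le_trans xXt)// gerBl.
Qed.

Variable u : R.
Let e (t : R) := expR (- (t / u)).

(** The Laplace transform at [1 / u]; the Sumudu transform at [u] is this value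
    divided by [u]. *)
Definition laplace f : R := \int[L]_(t in Rp) (e t * f t).

Definition laplace_integrable f : Prop :=
  L.-integrable Rp (EFin \o (fun t => e t * f t)).

Lemma laplace_integrable_measurable f :
  laplace_integrable f -> measurable_fun Rp f.
Proof.
move=> fL; have : measurable_fun Rp (fun t => expR (t / u) * (e t * f t)).
  apply: measurable_funM.
    apply: measurable_funTS; apply: measurableT_comp => //.
    exact: measurable_funM.
  by apply/measurable_EFinP; apply: measurable_int fL.
apply: eq_measurable_fun => t _.
by rewrite /e expRN mulrA divff ?mul1r// gt_eqF// expR_gt0.
Qed.

Lemma convol_exp f g x : measurable_fun Rp f -> measurable_fun Rp g ->
  convol (fun t => e t * f t) (fun t => e t * g t) x = e x * convol f g x.
Proof.
move=> mf mg; have sub : `[0, x]%classic `<=` Rp.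
  by move=> t /=; rewrite !in_itv/= andbT => /andP[].
rewrite /convol -Rintegral_gt0Zl//; last 2 first.
- by apply: measurable_convol_integrand; apply: measurable_funS sub _.
- exact: expR_gt0.
apply: eq_Rintegral => t _.
have -> : e x = e (x - t) * e t by rewrite /e -expRD; congr expR; ring.
ring.
Qed.

(** Since [e x = e (x - t) * e t], the weight [e] turns a truncated convolution
    into the convolution on the line of two integrable functions. *)
Theorem laplace_convol f g : laplace_integrable f -> laplace_integrable g ->
  laplace_integrable (convol f g) /\ laplace (convol f g) = laplace f * laplace g.
Proof.
move=> fL gL.
have mf := laplace_integrable_measurable fL.
have mg := laplace_integrable_measurable gL.
pose T h := (fun t => e t * h t) \_ Rp.
have TL h : laplace_integrable h -> L.-integrable setT (EFin \o T h).
  by move=> hL; rewrite -restrict_EFin; apply/integrable_restrict => //; rewrite setTI.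
have cE x : \int[L]_t (T f (x - t) * T g t) = e x * convol f g x.
  by rewrite convolE convol_exp.
split.
  have := convolution_integrable (TL _ fL) (TL _ gL) (measurable_itv `[0, +oo[).
  by apply: eq_integrable => // x _ /=; rewrite cE.
have -> : laplace (convol f g) = \int[L]_x (\int[L]_t (T f (x - t) * T g t)).
  rewrite /laplace Rintegral_mkcond; apply: eq_Rintegral => x _.
  rewrite cE patchE; case: ifPn => //.
  rewrite mem_setE in_itv/= andbT -ltNge => x0.
  rewrite /convol (_ : `[0, x]%classic = set0) ?Rintegral_set0 ?mulr0//.
  apply/seteqP; split => t //=; rewrite in_itv/= => /andP[t0 tx].
  by have := le_trans t0 tx; rewrite leNgt x0.
rewrite (integral_convolution (TL _ fL) (TL _ gL))//.
have inner t : \int[L]_(x in setT) T f (x - t) = laplace f.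
  rewrite /laplace [RHS]Rintegral_mkcond -/(T f); congr fine.
  have := @integral_translate R t setT (EFin \o T f) measurableT (measurable_int _ (TL _ fL)).
  have -> : [set x | setT (x - t)] = [set: R] by apply/seteqP; split.
  exact: id.
under eq_Rintegral do rewrite inner.
rewrite RintegralZr//; last exact: TL.
rewrite mulrC; congr (_ * _).
by rewrite /laplace [RHS]Rintegral_mkcond.
Qed.

End truncated_convolution.

(** * Absolutely continuous functions *)

Section absolute_continuity.
Context {R : realType}.
Implicit Types (a b e d x y : R) (g : R -> R).

Definition admissible a b d (J : finType) (l r : J -> R) : Prop :=
  [/\ forall i, a <= l i /\ l i <= r i /\ r i <= b,
      trivIset [set: J] (fun i => `]l i, r i[%classic) &
      \sum_i (r i - l i) < d].

(** Families indexed by an arbitrary finite type can be refined: a family of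
    partitions of the intervals of a family is indexed by a dependent sum. *)
Lemma abs_cont_finType a b g : abs_cont a b g ->
  forall e, 0 < e -> exists2 d, 0 < d &
    forall (J : finType) (l r : J -> R), admissible a b d l r ->
      \sum_i `|g (r i) - g (l i)| < e.
Proof.
move=> acg e e0; have [d d0 H] := acg e e0; exists d => // J l r [lr tI sumd].
pose v (i : 'I_#|J|)  : J := enum_val i.
have bigE (F : J -> R) : \sum_i F i = \sum_(i < #|J|) F (v i).
  by rewrite -(big_enum_val (A := J) F); apply: eq_bigl => i; rewrite inE.
rewrite bigE; apply: H => [i|i j _ _|]; first exact: lr.
  by move=> /(tI (v i) (v j) I I)/enum_val_inj.
by rewrite -(bigE (fun i => r i - l i)).
Qed.

Lemma itv_partition_nth_le a b (s : seq R) i j : itv_partition a b s ->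
  (i <= j <= size s)%N -> nth b (a :: s) i <= nth b (a :: s) j.
Proof.
move=> [ps _] /andP[ij js].
apply: (@sorted_leq_nth _ <=%R _ _ b (a :: s)) => //=.
- exact: le_trans.
- by apply: sub_path ps => x y /ltW.
- by rewrite inE /= ltnS (leq_trans ij).
Qed.

Lemma itv_partition_nth_size a b (s : seq R) : itv_partition a b s ->
  nth b (a :: s) (size s) = b.
Proof. by move=> [_ /eqP lb]; exact: etrans (nth_last b (a :: s)) lb. Qed.

(** Refining each interval of a family by a partition keeps it admissible, so
    absolute continuity controls sums of variations, not only of increments. *)
Lemma abs_cont_variation a b g : abs_cont a b g ->
  forall e, 0 < e -> exists2 d, 0 < d &
    forall (J : finType) (l r : J -> R) (s : J -> seq R), admissible a b d l r ->
      (forall i, itv_partition (l i) (r i) (s i)) ->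
      \sum_i variation (l i) (r i) g (s i) < e.
Proof.
move=> /abs_cont_finType acg e /acg[d d0 H]; exists d => // J l r s [lr tI sumd] ps.
pose node i j := nth (r i) (l i :: s i) j.
have node_le i j j' : (j <= j' <= size (s i))%N -> node i j <= node i j'.
  exact: itv_partition_nth_le (ps i).
have node0 i : node i 0%N = l i by [].
have nodes i : node i (size (s i)) = r i by exact: itv_partition_nth_size.
pose l' (p : {i : J & 'I_(size (s i))}) := node (tag p) (tagged p).
pose r' (p : {i : J & 'I_(size (s i))}) := node (tag p) (tagged p).+1.
have bigE (F : J -> nat -> R) : \sum_i \sum_(0 <= j < size (s i)) F i j =
    \sum_(p : {i : J & 'I_(size (s i))}) F (tag p) (tagged p).
  rewrite -(sig_big_dep xpredT (fun _ => xpredT) (fun i (j : 'I_(size (s i))) => F i j)).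
  by apply: eq_bigr => i _; rewrite big_mkord.
rewrite /variation /= (bigE (fun i j => `|g (node i j.+1) - g (node i j)|)).
apply: (H _ l' r'); split.
- move=> [i j] /=; rewrite /l' /r' /=; have [al [_ rb]] := lr i.
  rewrite node_le ?leqnSn ?ltn_ord//; split; last split => //.
    by apply: le_trans al _; rewrite -node0 node_le//= ltnW.
  by apply: le_trans rb; rewrite -nodes node_le//= ltn_ord leqnn.
- move=> [i j] [i' j'] _ _ [x [/=]]; rewrite !in_itv/= /l' /r' /=.
  move=> /andP[jx xj] /andP[j'x xj'].
  have ii' : i = i'.
    apply: (tI i i' I I); exists x; split => /=; rewrite in_itv/=; apply/andP; split.
    + by apply: le_lt_trans jx; rewrite -node0 node_le//= ltnW.
    + by apply: lt_le_trans xj _; rewrite -nodes node_le//= ltn_ord leqnn.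
    + by apply: le_lt_trans j'x; rewrite -node0 node_le//= ltnW.
    + by apply: lt_le_trans xj' _; rewrite -nodes node_le//= ltn_ord leqnn.
  case: i' / ii' j' j'x xj' => j' j'x xj'; congr (existT _ _ _); apply/val_inj => /=.
  apply/eqP; rewrite eqn_leq; apply/andP; split; rewrite leqNgt; apply/negP => jj'.
    have : node i j'.+1 <= node i j by rewrite node_le// jj' ltnW.
    by rewrite leNgt (lt_trans jx xj').
  have : node i j.+1 <= node i j' by rewrite node_le// jj' ltnW.
  by rewrite leNgt (lt_trans j'x xj).
rewrite /l' /r' -(bigE (fun i j => node i j.+1 - node i j)).
rewrite (eq_bigr (fun i => r i - l i))// => i _.
by rewrite telescope_sumr// nodes.
Qed.

(** The variation is at most 1 on every interval that is shorter than the [d]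
    given by absolute continuity for 1, and finitely many of them cover
    [[a, b]]. *)
Lemma abs_cont_bounded_variation a b g : a <= b -> abs_cont a b g ->
  bounded_variation a b g.
Proof.
move=> ab /abs_cont_variation/(_ 1 ltr01)[d d0 H].
have short x y : a <= x -> x <= y -> y <= b -> y - x < d ->
    bounded_variation x y g.
  move=> ax xy yb yxd; exists 1 => _ [s ps <-]; apply: ltW.
  have := H unit (fun=> x) (fun=> y) (fun=> s).
  rewrite big_const card_unit /= addr0; apply => //; split => //.
    by move=> [] [].
  by rewrite big_const card_unit /= addr0.
suff step n : forall x, a <= x -> x <= b -> x <= a + n%:R * (d / 2) ->
    bounded_variation a x g.
  apply: (step (Num.truncn ((b - a) / (d / 2))).+1 b) => //.
  rewrite -lerBlDl -ler_pdivrMr ?divr_gt0//; apply: ltW.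
  exact: truncnS_gt.
elim: n => [|n IH] x ax xb.
  rewrite mul0r addr0 => xa; have -> : x = a by apply/eqP; rewrite eq_le xa.
  exact: bounded_variationxx.
move=> xn; have [xs|xs] := leP (x - d / 2) a.
  by apply: short => //; lra.
have x'x : x - d / 2 <= x by lra.
apply/bounded_variationP => //.
rewrite (@total_variationD _ _ _ (x - d / 2)) ?(ltW xs)// fin_numD.
apply/andP; split; apply/bounded_variationP => //; first exact: ltW.
  apply: IH; [exact: ltW|lra|].
  by rewrite -natr1 mulrDl mul1r in xn; lra.
by apply: short => //; [exact: ltW|lra].
Qed.

Let TV g x y := fine (total_variation x y g).

Lemma total_variation_sub a b g x y : bounded_variation a b g ->
  a <= x -> x <= y -> y <= b -> TV g a y - TV g a x = TV g x y.
Proof.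
move=> bv ax xy yb.
have axfin : total_variation a x g \is a fin_num.
  by apply/bounded_variationP => //; apply: bounded_variationl bv => //; exact: le_trans yb.
have xyfin : total_variation x y g \is a fin_num.
  apply/bounded_variationP => //; apply: (bounded_variationl _ yb) => //.
  exact: bounded_variationr (le_trans xy yb) bv.
by rewrite /TV (total_variationD _ ax xy) fineD// addrC addKr.
Qed.

(** Each total variation is nearly the variation along some partition, so a sum
    of total variations is controlled by [abs_cont_variation]. *)
Lemma abs_cont_total_variation a b g : a <= b -> abs_cont a b g ->
  abs_cont a b (TV g a).
Proof.
move=> ab acg e e0; have bv := abs_cont_bounded_variation ab acg.
have [d d0 H] := abs_cont_variation acg (divr_gt0 e0 (ltr0Sn _ 1)).
exists d => // n l r lr tI sumd.
pose eta := e / 2 / n.+1%:R.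
have eta0 : 0 < eta by rewrite !divr_gt0.
have approx (i : 'I_n) : exists s : seq R, itv_partition (l i) (r i) s /\
    `|TV g a (r i) - TV g a (l i)| <= variation (l i) (r i) g s + eta.
  have [al [lri rb]] := lr i.
  rewrite (total_variation_sub bv)// ger0_norm; last first.
    by rewrite fine_ge0// total_variation_ge0.
  have lrfin : total_variation (l i) (r i) g \is a fin_num.
    apply/bounded_variationP => //; apply: (bounded_variationl _ rb) => //.
    exact: bounded_variationr (le_trans lri rb) bv.
  have [_ [_ [s ps <-] <-]] := ub_ereal_sup_adherent eta0 lrfin.
  rewrite -/(total_variation _ _ _) -(fineK lrfin) -EFinB lte_fin => sTV.
  by exists s; split => //; rewrite /TV; apply: ltW; rewrite -ltrBlDr.
have [s sP] := choice approx.
apply: (@le_lt_trans _ _ (\sum_(i < n) (variation (l i) (r i) g (s i) + eta))).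
  by apply: ler_sum => i _; have [] := sP i.
rewrite big_split /= [e]splitr ltr_leD//.
  by apply: H => [|i]; [split|have [] := sP i].
rewrite sumr_const card_ord -[eta *+ n]mulr_natl /eta mulrA ler_pdivrMr ?ltr0Sn//.
by rewrite mulrC ler_wpM2l ?ler_nat// ltW// divr_gt0.
Qed.

Lemma abs_contB a b (g h : R -> R) : abs_cont a b g -> abs_cont a b h ->
  abs_cont a b (g \- h).
Proof.
move=> acg ach e e0; have e20 : 0 < e / 2 by rewrite divr_gt0.
have [d d0 H] := acg _ e20; have [d' d'0 H'] := ach _ e20.
exists (Num.min d d'); first by rewrite lt_min d0.
move=> n l r lr tI; rewrite lt_min => /andP[sd sd'].
rewrite [e]splitr; apply: le_lt_trans (ltrD (H _ _ _ lr tI sd) (H' _ _ _ lr tI sd')).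
rewrite -big_split /=; apply: ler_sum => i _.
rewrite /= (_ : _ - _ - _ = g (r i) - g (l i) - (h (r i) - h (l i))); last by ring.
exact: ler_normB.
Qed.

(** The Jordan decomposition [g = V - (V - g)], in a form that keeps absolute
    continuity. *)
Lemma abs_cont_sub_total_variation a b g : a <= b -> abs_cont a b g ->
  exists V : R -> R, [/\ abs_cont a b V, abs_cont a b (V \- g),
    {in `[a, b] &, {homo V : x y / x <= y}} &
    {in `[a, b] &, {homo (V \- g) : x y / x <= y}}].
Proof.
move=> ab acg; have acV := abs_cont_total_variation ab acg.
have bv := abs_cont_bounded_variation ab acg.
exists (TV g a); split => //; first exact: abs_contB.
  move=> x y; rewrite !in_itv/= => /andP[ax xb] /andP[ay yb] xy.
  by rewrite -subr_ge0 (total_variation_sub bv)// fine_ge0// total_variation_ge0.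
move=> x y; rewrite !in_itv/= => /andP[ax xb] /andP[ay yb] xy.
rewrite -subr_ge0 (_ : _ - _ = TV g x y - (g y - g x)); last first.
  by rewrite -(total_variation_sub bv ax xy yb)/=; ring.
rewrite subr_ge0 (le_trans (ler_norm _))// -lee_fin fineK.
  exact: total_variation_ge.
apply/bounded_variationP => //; apply: (bounded_variationl _ yb) => //.
exact: bounded_variationr (le_trans xy yb) bv.
Qed.

End absolute_continuity.

(** * Densities of monotone absolutely continuous functions *)

Section stieltjes_density.
Context {R : realType}.
Local Notation L := (@lebesgue_measure R).

Lemma bounded_open_interval (A : set R) x y : open A -> is_interval A ->
  A `<=` `[x, y] -> exists l r : R, l <= r /\ A = `]l, r[%classic.
Proof.
move=> oA iA Axy; have [->|/set0P[z Az]] := eqVneq A set0.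
  by exists 0, 0; rewrite set_itvoo0.
have lA : has_lbound A by exists x => t /Axy/=; rewrite in_itv/= => /andP[].
have uA : has_ubound A by exists y => t /Axy/=; rewrite in_itv/= => /andP[].
exists (inf A), (sup A); split; first by rewrite (le_trans (ge_inf lA Az)) ?ub_le_sup.
by rewrite -[LHS](interior_id A).1// interval_bounded_interior.
Qed.

Variables (a b : R) (P : R -> R).
Hypotheses (ab : a <= b) (acP : abs_cont a b P).
Hypothesis ndP : {in `[a, b] &, {homo P : x y / x <= y}}.

(* A Stieltjes measure comes from a function on the whole line, so P is extended
   beyond [a, b] by its values at the end points. *)
Let clamp (x : R) : R := Num.max a (Num.min x b).

Let clamp_itv x : clamp x \in `[a, b].
Proof. by rewrite in_itv/= /clamp le_max lexx /= ge_max ab ge_min lexx orbT. Qed.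

Let clamp_id x : x \in `[a, b] -> clamp x = x.
Proof.
by rewrite in_itv/= => /andP[ax xb]; rewrite /clamp (min_idPl xb) (max_idPr ax).
Qed.

Let le_clamp x y : x <= y -> clamp x <= clamp y.
Proof. by move=> xy; rewrite /clamp le_max2 ?le_min2. Qed.

Let clamp_sub x y : x <= y -> clamp y - clamp x <= y - x.
Proof.
move=> xy; rewrite /clamp /Num.max /Num.min.
by case: ifPn; case: ifPn; case: ifPn; case: ifPn; rewrite -?leNgt; lra.
Qed.

Let clamp_oo x y : `]clamp x, clamp y[ `<=` `]x, y[.
Proof.
move=> t /=; rewrite !in_itv/= /clamp gt_max lt_max lt_min gt_min.
by move=> /andP[/andP[at_ +] +]; rewrite (le_gtF (ltW at_))/=;
  case/orP=> [xt|bt] /andP[ty tb]; rewrite ?xt ?ty//; have := lt_trans tb bt; rewrite ltxx.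
Qed.

Let Q : R -> R := P \o clamp.

Let Q_nondecreasing : {homo Q : x y / x <= y}.
Proof. by move=> x y xy; apply: ndP (le_clamp xy); exact: clamp_itv. Qed.

Let Q_abs_cont (e : R) : 0 < e -> exists2 d, 0 < d &
  forall n (l r : 'I_n -> R), (forall i, l i <= r i) ->
    trivIset setT (fun i => `]l i, r i[%classic) ->
    \sum_(i < n) (r i - l i) < d -> \sum_(i < n) (Q (r i) - Q (l i)) < e.
Proof.
move=> /acP[d d0 H]; exists d => // n l r lr tI sumd.
apply: le_lt_trans (H n (clamp \o l) (clamp \o r) _ _ _).
- by apply: ler_sum => i _; exact: ler_norm.
- move=> i; have /= := clamp_itv (l i); have /= := clamp_itv (r i).
  by rewrite !in_itv/= => /andP[_ ->] /andP[-> _]; rewrite le_clamp.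
- move=> i j _ _ [x [/= xi xj]]; apply: (tI i j I I).
  by exists x; split; exact: clamp_oo.
- by apply: le_lt_trans sumd; apply: ler_sum => i _; exact: clamp_sub.
Qed.

Let Q_right_continuous : right_continuous Q.
Proof.
move=> x; apply/cvgrPdist_lt => e /Q_abs_cont[d d0 H]; near=> y.
have xy : x <= y by near: y; exact: nbhs_right_ge.
rewrite distrC ger0_norm ?subr_ge0 ?Q_nondecreasing//.
have := H 1%N (fun=> x) (fun=> y); rewrite !big_ord1; apply => //.
  by move=> i j _ _ _; rewrite !ord1.
by rewrite ltrBlDl; near: y; apply: nbhs_right_lt; rewrite ltrDl.
Unshelve. all: by end_near. Qed.

HB.instance Definition _ :=
  isCumulative.Build R _ R Q Q_nondecreasing Q_right_continuous.

Let S : {measure set (measurableTypeR R) -> \bar R} := lebesgue_stieltjes_measure Q.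

Let S_itv x y : x <= y -> S `]x, y]%classic = (Q y - Q x)%:E.
Proof.
move=> xy; rewrite /S /= /lebesgue_stieltjes_measure /measure_extension.
rewrite measurable_mu_extE/=; last exact: is_ocitv.
by rewrite wlength_itv_bnd.
Qed.

(* A null set lies in an open set of small measure, the components of which are
   disjoint intervals of small total length. *)
Let S_null (A : set R) : measurable A -> L A = 0%E -> A `<=` `]a, b] -> S A = 0%E.
Proof.
move=> mA A0 Aab; apply/eqP; rewrite eq_le measure_ge0 andbT.
apply/lee_addgt0Pr => e e0; rewrite add0e.
have [d d0 H] := Q_abs_cont e0.
have [U [oU AU UA]] := @lebesgue_regularity_outer R A d mA
  (eq_ind_r (fun x => (x < +oo)%E) (ltry 0) A0) d0.
pose V := U `&` `]a - 1, b + 1[%classic.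
have oV : open V by apply: openI => //; exact: interval_open.
have AV : A `<=` V.
  move=> x Ax; split; first exact: AU.
  by have := Aab x Ax; rewrite /= !in_itv/= => /andP[? ?]; apply/andP; split; lra.
have mU : measurable U by exact: open_measurable.
have mV : measurable V by exact: open_measurable.
have Vd : (L V < d%:E)%E.
  have LVU : (L V <= L (U `\` A) + L A)%E.
    apply: le_trans (measureU2 _ _ _) => //; last exact: measurableD.
    apply: le_measure; rewrite ?inE//.
      by apply: measurableU => //; exact: measurableD.
    by move=> x [Ux _]; have [Ax|Ax] := pselect (A x); [right|left].
  by apply: le_lt_trans LVU _; rewrite A0 adde0.
pose C := open_disjoint_itv oV.
have VC : V = \bigcup_n C n by exact: open_disjoint_itv_bigcup.
have tC : trivIset setT C by exact: open_disjoint_itv_trivIset.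
have /choice[lr lrP] : forall n, exists p : R * R, p.1 <= p.2 /\ C n = `]p.1, p.2[%classic.
  move=> n; have [||x Cx|l [r [lr CE]]] := @bounded_open_interval (C n) (a - 1) (b + 1).
  - exact: open_disjoint_itv_open.
  - exact: open_disjoint_itv_is_interval.
  - have : V x by rewrite VC; exists n.
    by move=> [_] /=; rewrite !in_itv/= => /andP[? ?]; apply/andP; split; apply: ltW.
  - by exists (l, r).
have mC n : measurable (C n) by rewrite (lrP n).2.
have sumL n : \sum_(i < n) ((lr i).2 - (lr i).1) < d.
  rewrite -lte_fin; apply: le_lt_trans Vd.
  have -> : (\sum_(i < n) ((lr i).2 - (lr i).1))%:E = L (\big[setU/set0]_(i < n) C i).
    rewrite measure_bigsetU//= -sumEFin; apply: eq_bigr => i _.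
    have [le12 ->] := lrP i; rewrite lebesgue_measure_itv/= lte_fin EFinB.
    move: le12; rewrite le_eqVlt => /predU1P[->|->//].
    by rewrite ltxx subee.
  apply: le_measure; rewrite ?inE//; first by apply: bigsetU_measurable => i _; exact: mC.
  rewrite VC -bigcup_mkord => x [i _ Cx]; by exists i.
have SV : (S V <= e%:E)%E.
  rewrite VC measure_bigcup//; last by move=> i _; exact: mC.
  apply: lime_le.
    by apply: is_cvg_nneseries => n _ _; exact: measure_ge0.
  apply: nearW => n.
  rewrite (@le_trans _ _ (\sum_(0 <= i < n) (Q (lr i).2 - Q (lr i).1)%:E)%E)//.
    rewrite big_mkcond/=; apply: lee_sum => i _; rewrite mem_setT.
    have [le12 CE] := lrP i; rewrite -S_itv// CE; apply: le_measure; rewrite ?inE//.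
    by apply: subset_itvl; rewrite bnd_simp.
  rewrite big_mkord sumEFin lee_fin; apply/ltW/H => // [i|i j _ _].
    by have [] := lrP i.
  rewrite -(lrP i).2 -(lrP j).2 => /(tC _ _ I I) ij; exact: val_inj.
apply: le_trans SV; apply: le_measure; rewrite ?inE//.
Qed.

(** Radon-Nikodym applied to the Stieltjes measure of a monotone absolutely
    continuous function. *)
Lemma abs_cont_density : exists2 phi : R -> R, L.-integrable setT (EFin \o phi) &
  forall x, a <= x <= b -> P x - P a = \int[L]_(t in `]a, x]) phi t.
Proof.
have mab : measurable (`]a, b]%classic : set (measurableTypeR R)) by exact: measurable_itv.
have Sab : (S `]a, b]%classic < +oo)%E by rewrite S_itv// ltry.
pose nu := mfrestr mab Sab.
have nuL : nu `<< L.
  move=> N LN A mA AN; apply: S_null; [exact: measurableI| |by move=> x []].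
  by apply: LN; [exact: measurableI|move=> x [/AN]].
have [phi [phi0 phifin phiL phiE]] := @radon_nikodym_sigma_finite _ _ _ L nu nuL.
exists (fine \o phi).
  rewrite (_ : _ \o _ = phi)//; apply/funext => x /=; by rewrite fineK.
move=> x /andP[ax xb].
have : S `]a, x]%classic = (\int[L]_(t in `]a, x]) phi t)%E.
  rewrite -[in LHS](@setIidl _ `]a, x]%classic `]a, b]%classic).
    exact: phiE.
  by apply: subset_itvl; rewrite bnd_simp.
rewrite S_itv// /Q /= !clamp_id ?in_itv/= ?lexx ?ax ?ab// => PE.
rewrite /Rintegral; under eq_integral do rewrite fineK//.
by rewrite -PE.
Qed.

End stieltjes_density.

(** * The fundamental theorem of calculus *)

Section abs_cont_derivative.
Context {R : realType}.
Local Notation L := (@lebesgue_measure R).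

Lemma abs_cont_primitive (a b : R) (g : R -> R) : a <= b -> abs_cont a b g ->
  exists2 phi : R -> R, L.-integrable setT (EFin \o phi) &
  forall x, a <= x <= b -> g x - g a = \int[L]_(t in `]a, x]) phi t.
Proof.
move=> ab acg; have [V [acV acVg ndV ndVg]] := abs_cont_sub_total_variation ab acg.
have [p pL pE] := abs_cont_density ab acV ndV.
have [q qL qE] := abs_cont_density ab acVg ndVg.
exists (p \- q).
  rewrite (_ : _ \o _ = ((EFin \o p) \- (EFin \o q))%E)//.
  exact: integrableB.
move=> x axb; rewrite RintegralB//.
- by rewrite -pE// -qE//=; ring.
- by apply: integrableS pL.
- by apply: integrableS qL.
Qed.

(** The density of [abs_cont_primitive] is the derivative wherever the Lebesgue
    differentiation theorem holds, that is, off a null set [N].  The limit at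
    0+ is the value at 0 of the absolutely continuous function that agrees with
    [G] on ]0, B]. *)
Theorem AC0_derivative (B : R) (G : R -> R) : 0 < B -> AC0 B G ->
  exists phi : R -> R, exists N : set R,
  [/\ L.-integrable setT (EFin \o phi),
      measurable N /\ L N = 0%E,
      forall x : R, 0 < x < B -> ~ N x -> derive1 G x = phi x &
      forall x : R, 0 < x <= B ->
        G x = lim (G t @[t --> 0^'+]) + \int[L]_(t in `[0, x]) phi t].
Proof.
move=> B0 [h ach hG]; have [phi phiL phiE] := abs_cont_primitive (ltW B0) ach.
pose F x := \int[L]_(t in `]0, x]) phi t.
have hF x : 0 <= x <= B -> h x = h 0 + F x.
  by move=> xB; rewrite /F -phiE// addrC subrK.
have GF x : 0 < x <= B -> G x = h 0 + F x.
  by move=> /andP[x0 xB]; rewrite -hG ?x0// hF// ltW.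
have limG : lim (G t @[t --> 0^'+]) = h 0.
  apply/cvg_lim => //; apply/cvgrPdist_lt => e /ach[d d0 H]; near=> t.
  have t0 : 0 < t by near: t; exact: nbhs_right_gt.
  have tB : t <= B by near: t; exact: nbhs_right_le.
  rewrite -hG ?t0// distrC.
  have := H 1%N (fun=> 0) (fun=> t); rewrite !big_ord1; apply => //.
    by move=> i j _ _ _; rewrite !ord1.
  by rewrite subr0; near: t; exact: nbhs_right_lt.
have := @FTC1 R phi (BRight 0) _ (open_integrable_locally openT phiL).
have phiI y : L.-integrable `]0, y] (EFin \o phi) by apply: integrableS phiL.
move=> /(_ phiI)[N [mN N0 NF]].
exists phi, N; split => //; last first.
  move=> x /andP[x0 xB]; rewrite limG GF ?x0// /F; congr (_ + _).
  by rewrite Rintegral_itv_obnd_cbnd.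
move=> x /andP[x0 xB] Nx.
have [dF <-] : derivable F x 1 /\ derive1 F x = phi x.
  apply: contrapT => nF; apply: Nx; apply: NF => /= xF; apply: nF.
  by apply: xF; rewrite (@lte_fin R).
rewrite !derive1E.
have -> : 'D_1 F x = 'D_1 (cst (h 0) + F) x.
  by rewrite deriveD// derive_cst add0r.
apply: near_eq_derive; near=> y; apply: GF.
have y0 : 0 < y by near: y; exact: lt_nbhsr.
by rewrite y0 ltW//; near: y; exact: lt_nbhsl.
Unshelve. all: by end_near. Qed.

End abs_cont_derivative.

(** * Substitution of a power *)

Section power_substitution.
Context {R : realType}.
Local Notation L := (@lebesgue_measure R).

Lemma continuous_powR (p x : R) : 0 < x -> {for x, continuous (fun t : R => t `^ p)}.
Proof.
move=> x0; apply/differentiable_continuous/derivable1_diffP.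
by apply: derivable_powR; rewrite in_itv/= x0.
Qed.

Lemma positive_measurable (f : R -> R) :
  (forall x, 0 < x -> {for x, continuous f}) -> measurable_fun (`]0, +oo[%classic : set R) f.
Proof.
move=> cf; apply: open_continuous_measurable_fun => //.
by move=> x; rewrite inE/= in_itv/= andbT => /cf.
Qed.

Let D (n : nat) : set R := `[n.+1%:R^-1, n.+1%:R]%classic.

Let D_gt0 n x : D n x -> 0 < x.
Proof. by rewrite /D/= in_itv/= => /andP[+ _]; apply: lt_le_trans; rewrite invr_gt0. Qed.

Let D_nd : nondecreasing_seq D.
Proof.
move=> m n mn; apply/subsetPset; apply: subset_itv; rewrite bnd_simp.
  by rewrite lef_pV2 ?posrE// ler_nat ltnS.
by rewrite ler_nat ltnS.
Qed.

Let D_bigcup : \bigcup_n D n = `]0, +oo[%classic.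
Proof.
apply/seteqP; split => x /=.
  by move=> [n _ /D_gt0 x0]; rewrite in_itv/= x0.
rewrite in_itv/= andbT => x0.
exists (Num.truncn (Num.max x x^-1)) => //; rewrite /D/= in_itv/=.
set m := Num.truncn _; have : Num.max x x^-1 < m.+1%:R by exact: truncnS_gt.
rewrite gt_max => /andP[xm xVm]; rewrite (ltW xm) andbT.
by rewrite -[x]invrK lef_pV2 ?posrE ?invr_gt0// ltW.
Qed.

Variables (c p : R).
Hypotheses (c0 : 0 < c) (p0 : 0 < p).

Let F (t : R) := c * t `^ p.
Let F' (t : R) := c * (p * t `^ (p - 1)).

Let F_derive (t : R) : 0 < t -> is_derive t 1 F (F' t).
Proof. by move=> t0; have ? := is_derive1_powR p t0; apply: is_deriveZ. Qed.

Let F'E (t : R) : 0 < t -> derive1 F t = F' t.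
Proof. by move=> /F_derive[_ <-]; rewrite derive1E. Qed.

Let F_mono (s t : R) : 0 < s -> s < t -> F s < F t.
Proof.
by move=> s0 st; rewrite ltr_pM2l// gt0_ltr_powR// ?nnegrE ?ltW// (lt_trans s0).
Qed.

Let F'_cont (t : R) : 0 < t -> {for t, continuous F'}.
Proof.
move=> t0; apply: cvgM; first exact: cvg_cst.
by apply: cvgM; [exact: cvg_cst|exact: continuous_powR].
Qed.

Let dF_cont (t : R) : 0 < t -> {for t, continuous (derive1 F)}.
Proof.
move=> t0; suff : derive1 F s @[s --> t] --> derive1 F t by [].
rewrite F'E//.
apply: cvg_trans (F'_cont t0); apply: near_eq_cvg; near=> s.
by rewrite F'E//; near: s; exact: lt_nbhsr.
Unshelve. all: by end_near. Qed.

Let F_cont (t : R) : 0 < t -> {for t, continuous F}.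
Proof. by move=> t0; apply: cvgM; [exact: cvg_cst|exact: continuous_powR]. Qed.

Let F_gt0 t : 0 < t -> 0 < F t.
Proof. by move=> t0; rewrite mulr_gt0// powR_gt0. Qed.

(** The derivative of a power may be unbounded near 0 or near infinity, so the
    substitution is made on the compact intervals [D n], which exhaust ]0, oo[,
    and the limit is taken by monotone convergence. *)
Lemma integral_power_substitution (G : R -> R) :
  (forall x, 0 < x -> {for x, continuous G}) -> (forall x, 0 < x -> 0 <= G x) ->
  (\int[L]_(x in `]0%R, +oo[) (G x)%:E =
   \int[L]_(t in `]0%R, +oo[) (G (c * t `^ p) * (c * (p * t `^ (p - 1))))%:E)%E.
Proof.
move=> cG G0.
pose E n : set R := `[F n.+1%:R^-1, F n.+1%:R]%classic.
have n0 n : 0 < n.+1%:R^-1 :> R by rewrite invr_gt0.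
have nn n : n.+1%:R^-1 <= n.+1%:R :> R.
  by rewrite (@le_trans _ _ 1)// ?invf_le1// ler1n.
have F_le s t : 0 < s -> s <= t -> F s <= F t.
  by move=> s0; rewrite le_eqVlt => /predU1P[->//|/(F_mono s0)/ltW].
have E_gt0 n x : E n x -> 0 < x.
  by rewrite /E/= in_itv/= => /andP[+ _]; apply: lt_le_trans; exact: F_gt0.
have E_nd : nondecreasing_seq E.
  move=> m n mn; apply/subsetPset; apply: subset_itv; rewrite bnd_simp.
    by apply: F_le => //; rewrite lef_pV2 ?posrE// ler_nat ltnS.
  by apply: F_le => //; rewrite ler_nat ltnS.
have E_bigcup : \bigcup_n E n = `]0, +oo[%classic.
  apply/seteqP; split => x /=.
    by move=> [n _ /E_gt0 x0]; rewrite in_itv/= x0.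
  rewrite in_itv/= andbT => x0; pose t := (x / c) `^ p^-1.
  have t0 : 0 < t by rewrite powR_gt0// divr_gt0.
  have Ft : F t = x.
    rewrite /F /t -powRrM mulVf ?gt_eqF// powRr1 ?divr_ge0 ?ltW//.
    by rewrite mulrC divfK// gt_eqF.
  have : `]0, +oo[%classic t by rewrite /= in_itv/= t0.
  rewrite -D_bigcup => -[n _]; rewrite /D/= in_itv/= => /andP[nt tn].
  by exists n => //; rewrite /E/= in_itv/= -Ft !F_le.
have mG : measurable_fun (`]0, +oo[%classic : set R) G by exact: positive_measurable.
pose H t := G (F t) * F' t.
have cH t : 0 < t -> {for t, continuous H}.
  move=> t0; apply: cvgM; last exact: F'_cont.
  by apply: continuous_comp; [exact: F_cont|apply: cG; exact: F_gt0].
have mH : measurable_fun (`]0, +oo[%classic : set R) H by exact: positive_measurable.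
have H0 t : 0 < t -> 0 <= H t.
  move=> t0; rewrite mulr_ge0//; first exact/G0/F_gt0.
  exact: mulr_ge0 (ltW c0) (mulr_ge0 (ltW p0) (powR_ge0 _ _)).
have eqn n : (\int[L]_(x in E n) (G x)%:E = \int[L]_(t in D n) (H t)%:E)%E.
  rewrite (@integration_by_substitution_increasing R F G)//.
  - by apply: eq_integral => t /set_mem/D_gt0 t0; rewrite /H -F'E//.
  - move=> s t; rewrite !in_itv/= => /andP[ns _] _; apply: F_mono.
    exact: lt_le_trans ns.
  - move=> t; rewrite in_itv/= => /andP[nt _]; apply: dF_cont.
    exact: lt_trans nt.
  - apply/cvg_ex; exists (derive1 F n.+1%:R^-1); apply: cvg_at_right_filter.
    exact: dF_cont.
  - apply/cvg_ex; exists (derive1 F n.+1%:R); apply: cvg_at_left_filter.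
    exact: dF_cont.
  - split.
    + move=> t; rewrite in_itv/= => /andP[nt _].
      by have [] := F_derive (lt_trans (n0 n) nt).
    + by apply: cvg_at_right_filter; exact: F_cont.
    + by apply: cvg_at_left_filter; exact: F_cont.
  - apply: continuous_in_subspaceT => x; rewrite inE => /E_gt0; exact: cG.
have sD n : D n `<=` `]0, +oo[%classic by rewrite -D_bigcup; exact: bigcup_sup.
have sE n : E n `<=` `]0, +oo[%classic by rewrite -E_bigcup; exact: bigcup_sup.
have cvgE : ((\int[L]_(x in E n) (G x)%:E)%E @[n --> \oo] -->
    \int[L]_(x in \bigcup_n E n) (G x)%:E)%E.
  apply: ge0_nondecreasing_set_cvg_integral => //.
  - by move=> n; exact: measurable_itv.
  - by move=> n; apply/measurable_EFinP; apply: measurable_funS (sE n) mG.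
  - by move=> n x /E_gt0/G0; rewrite lee_fin.
have cvgD : ((\int[L]_(x in D n) (H x)%:E)%E @[n --> \oo] -->
    \int[L]_(x in \bigcup_n D n) (H x)%:E)%E.
  apply: ge0_nondecreasing_set_cvg_integral => //.
  - by move=> n; exact: measurable_itv.
  - by move=> n; apply/measurable_EFinP; apply: measurable_funS (sD n) mH.
  - by move=> n x /D_gt0/H0; rewrite lee_fin.
rewrite -[in LHS]E_bigcup -[in RHS]D_bigcup; apply: (cvg_unique _ cvgE) => //.
rewrite (_ : (fun n => _) = fun n => (\int[L]_(x in D n) (H x)%:E)%E)//.
by apply/funext => n; exact: eqn.
Qed.

End power_substitution.

(** * Gamma integrals *)

Section gamma_integral.
Context {R : realType}.
Local Notation L := (@lebesgue_measure R).
Local Notation Rp := (`[0, +oo[%classic : set R).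

Lemma exp_integrable (u : R) : 0 < u ->
  L.-integrable Rp (EFin \o (fun t => expR (- (t / u)))).
Proof.
move=> u0; have r0 : 0 < u^-1 by rewrite invr_gt0.
have : L.-integrable Rp (fun t => u%:E * (EFin \o exponential_pdf u^-1) t)%E.
  apply: integrableZl => //; apply: (@integrableS _ _ _ L setT) => //.
  exact: integrable_exponential_pdf.
apply: eq_integrable => // t; rewrite inE/= in_itv/= andbT => t0.
by rewrite exponential_pdfE// -EFinM mulrA divff ?gt_eqF// mul1r mulNr mulrC.
Qed.

Lemma measurable_expRN_div (u : R) (D : set R) :
  measurable_fun D (fun t => expR (- (t / u))).
Proof.
apply: measurable_funTS; apply: measurableT_comp => //.
by apply: measurableT_comp => //; exact: measurable_funM.
Qed.

Lemma laplace_cst1 (u : R) : 0 < u -> laplace_integrable u (fun=> 1) /\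
  laplace u (fun=> 1) = u.
Proof.
move=> u0; have r0 : 0 < u^-1 by rewrite invr_gt0.
split; first by apply: eq_integrable (exp_integrable u0) => // t _ /=; rewrite mulr1.
have : (\int[L]_x (exponential_pdf u^-1 x)%:E = 1)%E by exact: integral_exponential_pdf.
have -> : (\int[L]_x (exponential_pdf u^-1 x)%:E =
           \int[L]_(x in Rp) (u^-1 * expR (- (x / u)))%:E)%E.
  rewrite [RHS]integral_mkcond; apply: eq_integral => x _.
  rewrite patchE mem_setE in_itv/= andbT; case: ifPn => x0.
    by rewrite exponential_pdfE// mulNr (mulrC u^-1 x).
  by rewrite /exponential_pdf patchE mem_setE in_itv/= andbT (negbTE x0).
move=> /(congr1 fine)/=; rewrite -/(Rintegral _ _ _) RintegralZl//; last exact: exp_integrable.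
move=> eq1; rewrite /laplace; under eq_Rintegral do rewrite mulr1.
by rewrite -[LHS](mulKf (lt0r_neq0 r0)) eq1 mulr1 invrK.
Qed.

(* The substitution y = t^p makes this the integral of exp (- y). *)
Let exp_powR_integrable (p : R) : 0 < p ->
  L.-integrable Rp (EFin \o (fun t => expR (- t `^ p) * (p * t `^ (p - 1)))).
Proof.
move=> p0.
have mf (D : set R) : measurable_fun D (fun t : R => expR (- t `^ p) * (p * t `^ (p - 1))).
  apply: measurable_funTS; apply: measurable_funM; last exact: measurable_funM.
  by apply: measurableT_comp => //; apply: measurableT_comp.
apply/integrableP; split; first by apply/measurable_EFinP; exact: mf.
under eq_integral => t _ do
  rewrite gee0_abs ?lee_fin ?mulr_ge0 ?expR_ge0 ?powR_ge0 ?(ltW p0)//.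
rewrite -integral_itv_obnd_cbnd; last by apply/measurable_EFinP; exact: mf.
have := @integral_power_substitution R 1 p ltr01 p0 (fun y => expR (- (y / 1))).
have -> : (\int[L]_(t in `]0%R, +oo[)
      (expR (- (1 * t `^ p / 1)) * (1 * (p * t `^ (p - 1))))%:E =
  \int[L]_(t in `]0%R, +oo[) (expR (- t `^ p) * (p * t `^ (p - 1)))%:E)%E.
  by apply: eq_integral => t _; rewrite !mul1r divr1.
move=> <-.
- rewrite integral_itv_obnd_cbnd; last by apply/measurable_EFinP; exact: measurable_expRN_div.
  have /integrableP[_] := exp_integrable (@ltr01 R).
  apply: le_lt_trans; apply: ge0_le_integral => //.
  + by apply/measurable_EFinP; exact: measurable_expRN_div.
  + by apply: measurableT_comp => //; apply/measurable_EFinP; exact: measurable_expRN_div.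
  + by move=> t _; rewrite lee_fin ler_norm.
- move=> x _; apply: continuous_comp; last exact: continuous_expR.
  by apply: continuousN; apply: cvgM; [exact: cvg_id|exact: cvg_cst].
- by move=> x _; exact: expR_ge0.
Qed.

(** For [t <= 1] the integrand is compared with that of [exp_powR_integrable],
    in which [exp (- t^p)] is at least [exp (-1)]; for [t >= 1], with an
    exponential of half the rate, which absorbs any power of [t]. *)
Lemma gamma_integrable (u p : R) : 0 < u -> 0 < p ->
  L.-integrable Rp (EFin \o (fun t => expR (- (t / u)) * t `^ (p - 1))).
Proof.
move=> u0 p0; pose m := (Num.truncn p).+1.
pose A := expR 1 / p; pose C := m`!%:R * (2 * u) ^+ m.
have A0 : 0 < A by rewrite divr_gt0// expR_gt0.
have u20 : 0 < 2 * u by rewrite mulr_gt0.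
have C0 : 0 < C by rewrite mulr_gt0// ?exprn_gt0// ltr0n fact_gt0.
have bound : L.-integrable Rp (fun t =>
    A%:E * (EFin \o (fun t => expR (- t `^ p) * (p * t `^ (p - 1)))%R) t +
    C%:E * (EFin \o (fun t => expR (- (t / (2 * u)))))%R t)%E.
  apply: integrableD => //; apply: integrableZl => //.
    exact: exp_powR_integrable.
  exact: exp_integrable.
apply: le_integrable bound => //.
  apply/measurable_EFinP; apply: measurable_funM; first exact: measurable_expRN_div.
  by apply: measurable_funTS; exact: measurable_powR.
move=> t /=; rewrite in_itv/= andbT => t0; rewrite lee_fin.
have tp0 : 0 <= t `^ (p - 1) by exact: powR_ge0.
rewrite ger0_norm ?mulr_ge0 ?expR_ge0//; apply: le_trans (ler_norm _).
have term1 : 0 <= A * (expR (- t `^ p) * (p * t `^ (p - 1))).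
  exact: mulr_ge0 (ltW A0) (mulr_ge0 (expR_ge0 _) (mulr_ge0 (ltW p0) tp0)).
have term2 : 0 <= C * expR (- (t / (2 * u))) by exact: mulr_ge0 (ltW C0) (expR_ge0 _).
have [t1|t1] := leP t 1.
  apply: (@le_trans _ _ (A * (expR (- t `^ p) * (p * t `^ (p - 1))))); last by rewrite lerDl.
  have -> : A * (expR (- t `^ p) * (p * t `^ (p - 1))) = expR (1 - t `^ p) * t `^ (p - 1).
    rewrite expRD /A; field; exact: lt0r_neq0.
  apply: ler_wpM2r => //; rewrite ler_expR.
  have tp1 : t `^ p <= 1.
    by have := @ge0_ler_powR R p (ltW p0) t 1; rewrite powR1 !nnegrE; apply.
  have : 0 <= t / u by exact: divr_ge0 t0 (ltW u0).
  lra.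
apply: (@le_trans _ _ (C * expR (- (t / (2 * u))))); last by rewrite lerDr.
have -> : - (t / u) = - (t / (2 * u)) + - (t / (2 * u)) by field; exact: lt0r_neq0.
rewrite expRD -mulrA [leRHS]mulrC; apply: ler_wpM2l; first exact: expR_ge0.
rewrite expRN ler_pdivrMl ?expR_gt0//.
have tm : t `^ (p - 1) <= t ^+ m.
  rewrite -powR_mulrn//; apply: ler_powR; first exact: ltW.
  have : p < m%:R by exact: truncnS_gt.
  lra.
apply: le_trans tm _; have := @expR_ge1Dxn R (t / (2 * u)) (Num.truncn p).
move=> /(_ (divr_ge0 t0 (ltW u20))) expge.
have : (t / (2 * u)) ^+ m / m`!%:R <= expR (t / (2 * u)).
  by apply: le_trans expge; rewrite lerDr.
rewrite ler_pdivrMr ?ltr0n ?fact_gt0// expr_div_n ler_pdivrMr ?exprn_gt0//.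
by rewrite /C mulrA.
Qed.

Lemma integral_gt0_positive (f : R -> R) :
  (forall t, 0 < t -> 0 < f t) -> L.-integrable Rp (EFin \o f) ->
  0 < \int[L]_(t in Rp) f t.
Proof.
move=> f0 fL; have fL' : L.-integrable `]0, +oo[ (EFin \o f).
  by apply: integrableS fL => //; apply: subset_itvr; rewrite bnd_simp.
rewrite -Rintegral_itv_obnd_cbnd//.
rewrite lt_neqAle Rintegral_ge0 ?andbT; last first.
  by move=> t /=; rewrite in_itv/= andbT => /f0/ltW.
apply/eqP => I0.
have /ae_eq_integral_abs : (\int[L]_(x in `]0%R, +oo[) `|(EFin \o f) x| = 0)%E.
  transitivity (\int[L]_(x in `]0%R, +oo[) (f x)%:E)%E.
    apply: eq_integral => t /[!inE]/=; rewrite in_itv/= andbT => /f0/ltW ft.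
    by rewrite ger0_norm.
  by rewrite -[LHS]fineK ?(integrable_fin_num _ fL')// -/(Rintegral _ _ _) -I0.
case=> //; first exact: measurable_int fL'.
move=> N [mN N0 NF].
have : (L `]0%R, +oo[ <= L N)%E.
  apply: le_measure; rewrite ?inE// => t /= t0; apply: NF => /= /(_ t0)[] ft0.
  by move: t0; rewrite in_itv/= andbT => /f0; rewrite ft0 ltxx.
by rewrite N0 lebesgue_measure_itv/= ltry leye_eq.
Qed.

Let kGamma_integrand (k z t : R) := expR (- (t `^ k / k)) * t `^ (z - 1).

(* The substitution is t = (u / k) s^k. *)
Let kGamma_integral (k z u : R) : 0 < k -> 0 < z -> 0 < u ->
  (\int[L]_(t in Rp) (expR (- (t / u)) * (t `^ (z / k - 1) / k))%:E =
   ((u / k) `^ (z / k))%:E * \int[L]_(t in Rp) (kGamma_integrand k z t)%:E)%E.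
Proof.
move=> k0 z0 u0; have uk0 : 0 < u / k by rewrite divr_gt0.
have mg (D : set R) : measurable_fun D (kGamma_integrand k z).
  apply: measurable_funTS; apply: measurable_funM => //.
  apply: measurableT_comp => //; apply: measurableT_comp => //.
  by apply: measurable_funM => //; exact: measurable_powR.
rewrite -integral_itv_obnd_cbnd; last first.
  apply/measurable_EFinP; apply: measurable_funM; first exact: measurable_expRN_div.
  by apply: measurable_funTS; exact: measurable_funM.
rewrite -[in RHS]integral_itv_obnd_cbnd; last by apply/measurable_EFinP; exact: mg.
rewrite -ge0_integralZl_EFin//; last 3 first.
- by move=> t _; rewrite lee_fin mulr_ge0 ?expR_ge0 ?powR_ge0.
- by apply/measurable_EFinP; exact: mg.
- exact: powR_ge0.
rewrite (@integral_power_substitution R (u / k) k uk0 k0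
  (fun t => expR (- (t / u)) * (t `^ (z / k - 1) / k))).
- apply: eq_integral => t /[!inE]/=; rewrite in_itv/= andbT => t0.
  rewrite -EFinM; congr (_%:E); rewrite /kGamma_integrand.
  have -> : u / k * t `^ k / u = t `^ k / k by field; rewrite !lt0r_neq0.
  rewrite powRM ?powR_ge0 ?(ltW uk0)// -powRrM.
  have -> : k * (z / k - 1) = z - k by field; exact: lt0r_neq0.
  have -> : z - 1 = z - k + (k - 1) by ring.
  rewrite (@powRD _ t (z - k)); last by rewrite (gt_eqF t0) implybT.
  rewrite -(mulr_powRB1 (ltW uk0) (divr_gt0 z0 k0)).
  by field; exact: lt0r_neq0.
- move=> x x0; apply: cvgM.
    apply: continuous_comp; last exact: continuous_expR.
    by apply: continuousN; apply: cvgM; [exact: cvg_id|exact: cvg_cst].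
  by apply: cvgM; [exact: continuous_powR|exact: cvg_cst].
- by move=> x _; rewrite mulr_ge0 ?expR_ge0// divr_ge0 ?powR_ge0// ltW.
Qed.

Lemma laplace_integrable_powR (k z u : R) : 0 < k -> 0 < z -> 0 < u ->
  laplace_integrable u (fun t => t `^ (z / k - 1) / k).
Proof.
move=> k0 z0 u0; have : L.-integrable Rp (fun t => (k^-1)%:E *
    (EFin \o (fun t => expR (- (t / u)) * t `^ (z / k - 1))%R) t)%E.
  by apply: integrableZl => //; apply: gamma_integrable => //; exact: divr_gt0.
by apply: eq_integrable => // t _ /=; rewrite -EFinM; congr (_%:E); ring.
Qed.

Lemma laplace_powR (k z u : R) : 0 < k -> 0 < z -> 0 < u ->
  laplace u (fun t => t `^ (z / k - 1) / k) = (u / k) `^ (z / k) * kGamma k z.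
Proof.
move=> k0 z0 u0; rewrite /laplace /Rintegral kGamma_integral//.
rewrite fineM//.
have := integrable_fin_num _ (laplace_integrable_powR k0 z0 u0).
rewrite kGamma_integral// => /(_ (measurable_itv _)).
by case: (\int[L]_(t in _) _)%E => //=;
  rewrite ?gt0_muley ?gt0_muleNy ?lte_fin ?powR_gt0 ?divr_gt0.
Qed.

Lemma kGamma_gt0 (k z : R) : 0 < k -> 0 < z -> 0 < kGamma k z.
Proof.
move=> k0 z0; have kk0 : 0 < (k / k) `^ (z / k) by rewrite powR_gt0// divr_gt0.
rewrite -(pmulr_rgt0 _ kk0) -laplace_powR//; apply: integral_gt0_positive.
  by move=> t t0; rewrite mulr_gt0 ?expR_gt0// divr_gt0// powR_gt0.
exact: laplace_integrable_powR.
Qed.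

End gamma_integral.

(** * The binomial series *)

Section binomial_series.
Context {R : realType}.
Implicit Types (s x y r : R) (n : nat).

(** The coefficients of the expansion of [(1 - x)^(- s)]: up to the sign
    [(-1)^n], the binomial coefficients of [- s]. *)
Definition rising_binomial s n : R := (\prod_(i < n) (s + i%:R)) / n`!%:R.
Local Notation c := rising_binomial.

Lemma rising_binomial0 s : c s 0 = 1.
Proof. by rewrite /c big_ord0 fact0 divr1. Qed.

Lemma rising_binomialS s n : c s n.+1 = c s n * ((s + n%:R) / n.+1%:R).
Proof.
rewrite /c big_ord_recr/= factS natrM.
by field; rewrite ?nat1r ?pnatr_eq0 -?lt0n ?fact_gt0.
Qed.

Lemma rising_binomialSl s n : c s n.+1 = s * c (s + 1) n / n.+1%:R.
Proof.
rewrite /c big_ord_recl/= addr0 factS natrM.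
rewrite (eq_bigr (fun i : 'I_n => s + 1 + i%:R)); last first.
  by move=> i _; rewrite /bump/= -nat1r addrA.
by field; rewrite ?nat1r ?pnatr_eq0 -?lt0n ?fact_gt0.
Qed.

Lemma rising_binomial_pascal s n : c (s + 1) n.+1 - c s n.+1 = c (s + 1) n.
Proof.
rewrite rising_binomialS rising_binomialSl.
by field; rewrite nat1r pnatr_eq0.
Qed.

(* The ratio of consecutive terms tends to r < 1, so the terms are bounded. *)
Let bounded_terms s r : 0 < r < 1 -> exists M, forall n, `|c s n| * r ^+ n <= M.
Proof.
move=> /andP[r0 r1]; pose N := (Num.truncn (`|s| / (1 - r))).+1.
have step n : (N <= n)%N -> `|c s n.+1| * r ^+ n.+1 <= `|c s n| * r ^+ n.
  move=> Nn; rewrite rising_binomialS normrM exprS.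
  rewrite (_ : _ * _ = `|c s n| * r ^+ n * (`|(s + n%:R) / n.+1%:R| * r)); last by ring.
  apply: ler_piMr; first by rewrite mulr_ge0// exprn_ge0// ltW.
  rewrite normrM normfV [`|n.+1%:R|]ger0_norm// mulrAC ler_pdivrMr// mul1r.
  have sN : `|s| <= n%:R * (1 - r).
    rewrite -ler_pdivrMr ?subr_gt0//; apply: le_trans (ltW (truncnS_gt _)) _.
    by rewrite ler_nat.
  have : `|s + n%:R| * r <= (`|s| + n%:R) * r.
    by rewrite ler_pM2r// (le_trans (ler_normD _ _))// (ger0_norm (ler0n _ n)).
  have : `|s| * r <= `|s| by rewrite ler_piMr// ltW.
  rewrite -natr1; lra.
exists (\sum_(i < N.+1) `|c s i| * r ^+ i) => n.
have term_ge0 i : 0 <= `|c s i| * r ^+ i by rewrite mulr_ge0// exprn_ge0// ltW.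
have [nN|Nn] := leqP n N.
  by rewrite (bigD1 (Ordinal (nN : n < N.+1)%N))//= lerDl sumr_ge0.
rewrite -(subnK (ltnW Nn)); elim: (n - N)%N => [|m IH].
  by rewrite add0n (bigD1 ord_max)//= lerDl sumr_ge0.
by rewrite addSn; apply: le_trans (step _ (leq_addl _ _)) IH.
Qed.

Lemma rising_binomial_abs_cvg s x : `|x| < 1 ->
  cvgn (series (fun n => `|c s n| * `|x| ^+ n)).
Proof.
move=> x1; pose r := (`|x| + 1) / 2.
have x0 : 0 <= `|x| by [].
have xr : `|x| < r by rewrite /r; lra.
have r0 : 0 < r by rewrite /r; lra.
have r1 : r < 1 by rewrite /r; lra.
have [M HM] : exists M, forall n, `|c s n| * r ^+ n <= M.
  by apply: bounded_terms; rewrite r0.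
have M0 : 0 <= M by apply: le_trans (HM 0%N); rewrite mulr_ge0.
apply: (@series_le_cvg _ _ (geometric M (`|x| / r))).
- by move=> n; rewrite mulr_ge0.
- by move=> n /=; rewrite mulr_ge0// exprn_ge0// divr_ge0// ltW.
- move=> n /=; rewrite expr_div_n mulrCA mulrC.
  by apply: ler_wpM2l; rewrite ?exprn_ge0// ler_pdivlMr ?exprn_gt0.
- apply: is_cvg_geometric_series.
  by rewrite ger0_norm ?divr_ge0 ?(ltW r0)// ltr_pdivrMr// mul1r.
Qed.

Lemma rising_binomial_cvg s x : `|x| < 1 -> cvgn (pseries (c s) x).
Proof.
move=> x1; apply: normed_cvg; rewrite /normed_series_of /=.
rewrite (_ : (fun _ => _) = (fun n => `|c s n| * `|x| ^+ n)).
  exact: rising_binomial_abs_cvg.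
by apply/funext => n; rewrite normrM normrX.
Qed.

Let f s x : R := limn (pseries (c s) x).

Let diffsE s : pseries_diffs (c s) = (fun n => s * c (s + 1) n).
Proof.
apply/funext => n; rewrite /pseries_diffs rising_binomialSl mulrC divfK//.
Qed.

Let pseriesZ (a : R) (u : nat -> R) x :
  pseries (fun n => a * u n) x = (fun n => a * pseries u x n).
Proof.
apply/funext => n; rewrite /pseries /series /= mulr_sumr.
by apply: eq_bigr => i _; rewrite mulrA.
Qed.

Let cvgZ (a : R) (u : nat -> R) x : cvgn (pseries u x) ->
  cvgn (pseries (fun n => a * u n) x).
Proof. by move=> cu; rewrite pseriesZ; apply: is_cvgM => //; exact: is_cvg_cst. Qed.

(* Differentiation takes the coefficients for s to s times those for s + 1, so
   the derived series converge for the same reason as the series itself. *)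
Let f_derive s x : `|x| < 1 -> is_derive x (1 : R) (f s) (s * f (s + 1) x).
Proof.
move=> x1; pose K := (`|x| + 1) / 2.
have x0 : 0 <= `|x| by [].
have K0 : 0 <= K by rewrite /K; lra.
have xK : `|x| < `|K| by rewrite (ger0_norm K0) /K; lra.
have K1 : `|K| < 1 by rewrite (ger0_norm K0) /K; lra.
have -> : s * f (s + 1) x = limn (pseries (pseries_diffs (c s)) x).
  rewrite diffsE pseriesZ limM//; last exact: rising_binomial_cvg.
    by rewrite lim_cst.
  exact: is_cvg_cst.
apply: (@pseries_snd_diffs _ _ K) => //.
- exact: rising_binomial_cvg.
- by rewrite diffsE; apply: cvgZ; exact: rising_binomial_cvg.
rewrite diffsE.
rewrite (_ : pseries_diffs _ = fun n => s * ((s + 1) * c (s + 1 + 1) n)).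
  by do 2 apply: cvgZ; exact: rising_binomial_cvg.
apply/funext => n; rewrite -(congr1 (fun g => g n) (diffsE (s + 1))) /pseries_diffs.
by ring.
Qed.

Let f_shift s x : `|x| < 1 -> (1 - x) * f (s + 1) x = f s x.
Proof.
move=> x1; have cs t : cvgn (pseries (c t) x) by exact: rising_binomial_cvg.
have term t : (fun n => c t n * x ^+ n) @ \oo --> 0 by apply: cvg_series_cvg_0; exact: cs.
have partial n : (1 - x) * pseries (c (s + 1)) x n =
    pseries (c s) x n - (c (s + 1) n * x ^+ n - c s n * x ^+ n).
  rewrite /pseries; elim: n => [|n IH].
    by rewrite /series/= !big_geq// !rising_binomial0; ring.
  have := IH; rewrite !(seriesSr _ n)/= mulrDr => ->.
  rewrite -[c (s + 1) n.+1](subrK (c s n.+1)) rising_binomial_pascal exprS.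
  ring.
have l1 : (1 - x) * pseries (c (s + 1)) x n @[n --> \oo] --> (1 - x) * f (s + 1) x.
  by apply: cvgM; [exact: cvg_cst|exact: cs].
have l2 : (1 - x) * pseries (c (s + 1)) x n @[n --> \oo] --> f s x - (0 - 0).
  under eq_fun do rewrite partial.
  by apply: cvgB; [exact: cs|apply: cvgB; exact: term].
by rewrite (cvg_unique _ l1 l2)// !subr0.
Qed.

Let f0 s : f s 0 = 1.
Proof.
apply/cvg_lim => //; apply: (@cvg_trans _ (cst 1 @ \oo)); last exact: cvg_cst.
apply: near_eq_cvg; exists 1%N => // -[//|n] _ /=.
rewrite /pseries /series/= big_nat_recl//= rising_binomial0 expr0 mul1r.
by rewrite big1 ?addr0// => i _; rewrite expr0n mulr0.
Qed.

(** The sum [f] of the series satisfies [(1 - x) * f' = s * f], so that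
    [f * (1 - x)^s] is constant. *)
Theorem binomial_series s x : `|x| < 1 ->
  limn (pseries (c s) x) = (1 - x) `^ (- s).
Proof.
move=> x1; rewrite -/(f s x).
pose h y := f s y * (1 - y) `^ s.
have sub1_gt0 y : `|y| < 1 -> 0 < 1 - y by rewrite ltr_norml subr_gt0 => /andP[].
have dh y : `|y| < 1 -> is_derive y (1 : R) h 0.
  move=> y1; have y0 := sub1_gt0 y y1.
  have d1 := f_derive s y1.
  have d2 : is_derive y (1 : R) (fun z : R => 1 - z) (- 1).
    have := is_deriveB (is_derive_cst (1 : R) y 1) (is_derive_id y (1 : R)).
    by rewrite sub0r.
  have d3 := is_derive1_powR s y0.
  have d4 : is_derive y (1 : R) (fun z => (1 - z) `^ s) (- (s * (1 - y) `^ (s - 1))).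
    rewrite -[X in is_derive _ _ _ X]mulrN1.
    exact: (@is_derive1_comp R (fun t : R => t `^ s) (fun z => 1 - z) y _ _ d3 d2).
  suff <- : f s y *: - (s * (1 - y) `^ (s - 1)) + (1 - y) `^ s *: (s * f (s + 1) y) = 0.
    exact: is_deriveM d1 d4.
  have -> : (1 - y) `^ s = (1 - y) * (1 - y) `^ (s - 1).
    rewrite -[X in X * _](powRr1 (ltW y0)) -powRD; first by congr (_ `^ _); ring.
    by rewrite (gt_eqF y0) implybT.
  by rewrite -(f_shift s y1) /GRing.scale/=; ring.
have hcst a b : -1 < a -> a <= b -> b < 1 -> h b = h a.
  move=> a1 ab b1; have ab1 y : y \in `[a, b] -> `|y| < 1.
    rewrite in_itv/= ltr_norml => /andP[ay yb].
    by rewrite (lt_le_trans a1 ay) (le_lt_trans yb b1).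
  have [||z _] := @MVT_segment R h (cst 0) a b ab.
  - by move=> y yab; apply/dh/ab1; apply: subset_itv_oo_cc yab.
  - by apply: derivable_within_continuous => y /ab1/dh[].
  by rewrite /= mul0r => /eqP; rewrite subr_eq0 => /eqP.
have hx1 : h x = 1.
  have <- : h 0 = 1 by rewrite /h f0 subr0 powR1 mulr1.
  move: x1; rewrite ltr_norml => /andP[x1 x1'].
  have [x0|x0] := leP 0 x; first by apply: hcst; rewrite ?ltrN10.
  by apply/esym/hcst; rewrite ?(ltW x0).
have p0 : (1 - x) `^ s != 0 by rewrite gt_eqF// powR_gt0// sub1_gt0.
by rewrite powRN -[LHS](mulfK p0) -/(h x) hx1 mul1r.
Qed.

End binomial_series.

(** * Termwise integration *)

Section series_of_integrals.
Context d (T : measurableType d) (R : realType) (mu : {measure set T -> \bar R}).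
Variables (D : set T) (F : nat -> T -> R).
Hypotheses (mD : measurable D) (FD : forall n, mu.-integrable D (EFin \o F n)).
Hypothesis sumF : cvgn (series (fun n => \int[mu]_(x in D) `|F n x|)).

Let g (x : T) : \bar R := (\sum_(n <oo) `|F n x|%:E)%E.

Let mF n : measurable_fun D (F n).
Proof. by apply/measurable_EFinP; exact: measurable_int (FD n). Qed.

Let mabsF n : measurable_fun D (fun x => `|F n x|%:E).
Proof. by apply/measurable_EFinP; apply: measurableT_comp. Qed.

Let g_integrable : mu.-integrable D g.
Proof.
have g0 x : (0 <= g x)%E by apply: nneseries_ge0 => n _ _; rewrite lee_fin.
apply/integrableP; split.
  by apply: ge0_emeasurable_sum => n //.
under eq_integral do rewrite gee0_abs//.
rewrite integral_nneseries//.
have -> : (\sum_(n <oo) \int[mu]_(x in D) `|F n x|%:E =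
           \sum_(n <oo) (\int[mu]_(x in D) `|F n x|)%:E)%E.
  apply: eq_eseriesr => n _; rewrite fineK//.
  apply: integrable_fin_num => //; exact: integrable_norm.
have -> : (\sum_(n <oo) (\int[mu]_(x in D) `|F n x|)%:E)%E =
    (limn (series (fun n => \int[mu]_(x in D) `|F n x|)))%:E.
  rewrite -EFin_lim//; congr (limn _); apply/funext => n.
  by rewrite /= sumEFin.
exact: ltry.
Qed.

(** A series with a finite integral is finite almost everywhere. *)
Lemma ae_abs_cvg_series : exists N : set T, [/\ measurable N, mu N = 0%E &
  forall x, D x -> ~ N x -> cvgn (series (fun n => `|F n x|))].
Proof.
have [N [mN N0 NF]] := integrable_ae mD g_integrable.
exists N; split => // x Dx Nx.
have gfin : g x \is a fin_num.
  by apply: contrapT => gx; apply: Nx; apply: NF => /= /(_ Dx).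
apply: nnseries_is_cvg => //.
by move: gfin; rewrite fin_numElt => /andP[].
Qed.

(** Dominated convergence; the bound is the sum [g] of the absolute values. *)
Lemma cvg_series_integral (s : T -> R) :
  (forall x, D x -> series (fun n => F n x) n @[n --> \oo] --> s x) ->
  mu.-integrable D (EFin \o s) /\
  series (fun n => \int[mu]_(x in D) F n x) n @[n --> \oo] --> \int[mu]_(x in D) s x.
Proof.
move=> Fs; pose f n x := (series (fun k => F k x) n)%:E.
have mf n : measurable_fun D (f n).
  apply/measurable_EFinP; rewrite /series/=; exact: measurable_sum.
have fs x : D x -> f n x @[n --> \oo] --> (s x)%:E.
  by move=> Dx; apply/cvg_EFin; [exact: nearW|exact: Fs].
have fg x n : D x -> (`|f n x| <= g x)%E.
  move=> Dx; rewrite /f/=; apply: (@le_trans _ _ (\sum_(0 <= k < n) `|F k x|%:E)%E).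
    by rewrite sumEFin lee_fin; exact: ler_norm_sum.
  by apply: nneseries_lim_ge => k _; rewrite lee_fin.
have ms : measurable_fun D (EFin \o s) by apply: (emeasurable_fun_cvg f).
have [sD _ fint] := dominated_convergence mD mf ms (aeW _ fs) g_integrable
  (aeW _ (fun x n => fg x n)).
split => //; have sfin := integrable_fin_num mD sD.
have sumE n : mu.-integrable D (EFin \o (fun x => series (fun k => F k x) n)) /\
    \int[mu]_(x in D) series (fun k => F k x) n =
    series (fun k => \int[mu]_(x in D) F k x) n.
  elim: n => [|n [IH1 IH2]].
    rewrite /series/= big_geq//; split.
      by apply: eq_integrable (integrable0 mu D) => // x _ /=; rewrite big_geq.
    by rewrite -[RHS](mul0r (fine (mu D))) -Rintegral_cst//;
      apply: eq_Rintegral => x _; rewrite big_geq.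
  split.
    by apply: eq_integrable (integrableD mD IH1 (FD n)) => // x _ /=; rewrite seriesSr.
  rewrite seriesSr/= -IH2 -RintegralD//; apply: eq_Rintegral => x _.
  by rewrite seriesSr.
move: fint; rewrite -[X in _ --> X](fineK sfin) => /fine_cvgP[_].
apply: cvg_trans; apply: near_eq_cvg; near=> n.
by rewrite -(sumE n).2.
Unshelve. all: by end_near. Qed.

End series_of_integrals.

(** * The k-Prabhakar kernel *)

Section mittag_leffler_kernel.
Context {R : realType}.
Local Notation L := (@lebesgue_measure R).
Local Notation Rp := (`[0, +oo[%classic : set R).
Variables (k alpha a g omega u : R).
Hypotheses (k0 : 0 < k) (alpha0 : 0 < alpha) (a0 : 0 < a) (u0 : 0 < u).

Let e (t : R) := expR (- (t / u)).
Let x := omega * k * (u / k) `^ (alpha / k).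
Hypothesis x1 : `|x| < 1.

Let coef n : R := kpochhammer k g n / kGamma k (alpha * n%:R + a).

Let mlterm (z : R) n : R := coef n * (z ^+ n / n`!%:R).

Let order n : R := alpha * n%:R + a.

Let order_gt0 n : 0 < order n.
Proof. by rewrite ltr_wpDl// mulr_ge0// ltW. Qed.

Let term n (t : R) : R := t `^ (a / k - 1) / k * mlterm (omega * t `^ (alpha / k)) n.

Let d n : R := coef n * (omega ^+ n / n`!%:R).

Let termE n (t : R) : 0 < t -> term n t = d n * (t `^ (order n / k - 1) / k).
Proof.
move=> t0; rewrite /term /mlterm /d exprMn -(powR_mulrn n (powR_ge0 t (alpha / k))) -powRrM.
have -> : order n / k - 1 = a / k - 1 + alpha / k * n%:R.
  by rewrite /order; field; exact: lt0r_neq0.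
rewrite (@powRD _ t (a / k - 1)) ?(gt_eqF t0) ?implybT//; field.
by rewrite lt0r_neq0//= pnatr_eq0 -lt0n fact_gt0.
Qed.

Let norm_termE n (t : R) : 0 < t -> `|term n t| = `|d n| * (t `^ (order n / k - 1) / k).
Proof.
move=> t0; rewrite termE// normrM; congr (_ * _).
by rewrite ger0_norm// divr_ge0 ?powR_ge0// ltW.
Qed.

Let powLI n := laplace_integrable_powR k0 (order_gt0 n) u0.

Let measurable_term n (D : set R) : measurable_fun D (term n).
Proof.
apply: measurable_funTS; apply: measurable_funM.
  by apply: measurable_funM => //; exact: measurable_powR.
apply: measurable_funM => //; apply: measurable_funM => //.
apply: measurable_funX; apply: measurable_funM => //; exact: measurable_powR.
Qed.

Let term_integrable n : laplace_integrable u (term n).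
Proof.
have dL : L.-integrable Rp (fun t => `|d n|%:E *
    (EFin \o (fun t => e t * (t `^ (order n / k - 1) / k))%R) t)%E.
  by apply: integrableZl => //; exact: powLI.
apply: le_integrable dL => //.
  apply/measurable_EFinP; apply: measurable_funM; first exact: measurable_expRN_div.
  exact: measurable_term.
move=> t /=; rewrite in_itv/= andbT le_eqVlt lee_fin => /predU1P[<-|t0].
  (* At t = 0 the series reduces to its term of index 0. *)
  have z0 : 0 `^ (alpha / k) = 0 :> R by rewrite powR0// gt_eqF// divr_gt0.
  rewrite /term /mlterm z0 mulr0 expr0n.
  case: n => [|n]; last by rewrite /= !(mul0r, mulr0) normr0.
  rewrite /d /order !expr0 mulr0n mulr0 add0r !normrM !normr_id /=.
  rewrite le_eqVlt; apply/orP; left; apply/eqP; ring.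
rewrite normrM norm_termE// [leRHS]normrM normr_id mulrCA [`|e t * _|]normrM.
by rewrite [`|_ / k|]ger0_norm// divr_ge0 ?powR_ge0// ltW.
Qed.

Let mset0 : measurable ([set 0] : set (measurableTypeR R)).
Proof. exact: measurable_set1. Qed.

Let null0 : L [set 0] = 0%E.
Proof. exact: lebesgue_measure_set1. Qed.

(* The gamma factor in the coefficients of the Mittag-Leffler series is the one
   that the Laplace integral of a power produces. *)
Let coef_gamma_cancel n : d n * ((u / k) `^ (order n / k) * kGamma k (order n)) =
  (u / k) `^ (a / k) * (rising_binomial (g / k) n * x ^+ n).
Proof.
have uk0 : 0 < u / k by rewrite divr_gt0.
have -> : (u / k) `^ (order n / k) = (u / k) `^ (a / k) * ((u / k) `^ (alpha / k)) ^+ n.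
  rewrite -(powR_mulrn n (powR_ge0 (u / k) (alpha / k))) -powRrM -powRD.
    by congr (_ `^ _); rewrite /order; ring.
  by rewrite (gt_eqF uk0) implybT.
rewrite /d /coef -/(order n) /x /rising_binomial !exprMn.
have -> : kpochhammer k g n = k ^+ n * \prod_(i < n) (g / k + i%:R).
  rewrite /kpochhammer -[n in k ^+ n]card_ord -prodr_const -big_split/=.
  by apply: eq_bigr => i _; field; exact: lt0r_neq0.
have Gn := lt0r_neq0 (kGamma_gt0 k0 (order_gt0 n)).
by field; rewrite Gn/= pnatr_eq0 -lt0n fact_gt0.
Qed.

Let laplace_term n :
  laplace u (term n) = (u / k) `^ (a / k) * (rising_binomial (g / k) n * x ^+ n).
Proof.
rewrite -coef_gamma_cancel -laplace_powR// /laplace -RintegralZl//; last exact: powLI.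
apply: (Rintegral_off_null mset0 null0) => t /=.
rewrite in_itv/= andbT le_eqVlt => /predU1P[<-//|t0 _].
by rewrite termE// mulrCA.
Qed.

Let laplace_norm_term n : \int[L]_(t in Rp) `|e t * term n t| =
  (u / k) `^ (a / k) * (`|rising_binomial (g / k) n| * `|x| ^+ n).
Proof.
rewrite -normrX -normrM -[X in X * _]ger0_norm ?powR_ge0// -normrM.
rewrite -coef_gamma_cancel normrM.
rewrite -laplace_powR// [X in _ * X]ger0_norm; last first.
  apply: Rintegral_ge0 => t _; rewrite mulr_ge0 ?expR_ge0//.
  by rewrite divr_ge0 ?powR_ge0// ltW.
rewrite /laplace -RintegralZl//; last exact: powLI.
apply: (Rintegral_off_null mset0 null0) => t /=.
rewrite in_itv/= andbT le_eqVlt => /predU1P[<-//|t0 _].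
by rewrite normrM norm_termE// ger0_norm ?expR_ge0// mulrCA.
Qed.

Let sum_norm_term : cvgn (series (fun n => \int[L]_(t in Rp) `|e t * term n t|)).
Proof.
have -> : (fun n => \int[L]_(t in Rp) `|e t * term n t|) =
    (u / k) `^ (a / k) *: (fun n => `|rising_binomial (g / k) n| * `|x| ^+ n).
  by apply/funext => n; rewrite laplace_norm_term.
by apply: is_cvg_seriesZ; exact: rising_binomial_abs_cvg.
Qed.

(* By the finiteness of the integrals the series converges absolutely at almost
   every point, hence at some s > t; and a power series that converges at a point
   converges at all points that are closer to 0. *)
Let mlterm_cvg (t : R) : 0 <= t -> cvgn (series (mlterm (omega * t `^ (alpha / k)))).
Proof.
move=> t0; have [N [mN N0 NF]] :=
  @ae_abs_cvg_series _ _ _ L Rp (fun n t => e t * term n t)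
  (measurable_itv _) term_integrable sum_norm_term.
have [s ts Ns] : exists2 s, t < s & ~ N s.
  apply: contrapT => nex.
  have : (L `]t, (t + 1)%R[ <= L N)%E.
    apply: le_measure; rewrite ?inE// => s /=; rewrite in_itv/= => /andP[ts _].
    by apply: contrapT => Ns; apply: nex; exists s.
  rewrite N0 lebesgue_measure_itv/= lte_fin ltrDl ltr01 -EFinB.
  by rewrite addrAC subrr add0r lee_fin ler10.
have s0 : 0 < s by apply: le_lt_trans ts.
have Rps : Rp s by rewrite /= in_itv/= ltW.
have c0 : 0 < e s * (s `^ (a / k - 1) / k).
  by rewrite mulr_gt0 ?expR_gt0// divr_gt0// powR_gt0.
have sP : cvgn (series (fun n => `|mlterm (omega * s `^ (alpha / k)) n|)).
  have := is_cvg_seriesZ (k := (e s * (s `^ (a / k - 1) / k))^-1) (NF s Rps Ns).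
  rewrite (_ : _ *: _ = fun n => `|mlterm (omega * s `^ (alpha / k)) n|)//.
  apply/funext => n.
  transitivity ((e s * (s `^ (a / k - 1) / k))^-1 * `|e s * term n s|) => //.
  have -> : e s * term n s =
      e s * (s `^ (a / k - 1) / k) * mlterm (omega * s `^ (alpha / k)) n.
    by rewrite /term mulrA.
  rewrite normrM (gtr0_norm c0); exact: mulKf (lt0r_neq0 c0) _.
apply: normed_cvg; apply: series_le_cvg sP => // n; first exact: normr_ge0.
rewrite /= /mlterm ![`|coef n * _|]normrM; apply: ler_wpM2l => //.
rewrite ![`|_ ^+ n / _|]normrM; apply: ler_wpM2r => //; rewrite !normrX.
apply: lerXn2r; rewrite ?nnegrE// !normrM; apply: ler_wpM2l => //.
rewrite !ger0_norm ?powR_ge0//; apply: ge0_ler_powR; rewrite ?nnegrE ?(ltW s0) ?(ltW ts)//.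
by rewrite divr_ge0 ?ltW.
Qed.

Definition kPrabhakar_kernel (t : R) : R :=
  t `^ (a / k - 1) / k * kMittagLeffler k alpha a g (omega * t `^ (alpha / k)).

(** Term by term, the Laplace integral of the kernel is a binomial series. *)
Theorem laplace_kPrabhakar_kernel : laplace_integrable u kPrabhakar_kernel /\
  laplace u kPrabhakar_kernel = (u / k) `^ (a / k) * (1 - x) `^ (- (g / k)).
Proof.
have [|KL Klim] := @cvg_series_integral _ _ _ L Rp (fun n t => e t * term n t)
  (measurable_itv _) term_integrable sum_norm_term (fun t => e t * kPrabhakar_kernel t).
  move=> t /=; rewrite in_itv/= andbT => t0.
  have -> : series (fun n => e t * term n t) =
      fun n => e t * (t `^ (a / k - 1) / k) * series (mlterm (omega * t `^ (alpha / k))) n.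
    by apply/funext => n; rewrite /series/= mulr_sumr; apply: eq_bigr => i _; exact: mulrA.
  have -> : e t * kPrabhakar_kernel t = e t * (t `^ (a / k - 1) / k) *
      limn (series (mlterm (omega * t `^ (alpha / k)))) by exact: mulrA.
  by apply: cvgM; [exact: cvg_cst|exact: mlterm_cvg].
split => //; rewrite /laplace.
have lim2 : series (fun n => \int[L]_(t in Rp) (e t * term n t)) n @[n --> \oo] -->
    (u / k) `^ (a / k) * (1 - x) `^ (- (g / k)).
  rewrite -(binomial_series _ x1).
  have -> : series (fun n => \int[L]_(t in Rp) (e t * term n t)) =
      fun n => (u / k) `^ (a / k) * pseries (rising_binomial (g / k)) x n.
    apply/funext => n; rewrite /pseries /series/= mulr_sumr.
    by apply: eq_bigr => i _; exact: laplace_term.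
  by apply: cvgM; [exact: cvg_cst|exact: rising_binomial_cvg].
exact: cvg_unique Klim lim2.
Qed.

End mittag_leffler_kernel.

(** * The k-Prabhakar operator under the Laplace integral *)

Section kPrabhakar_laplace.
Context {R : realType}.
Local Notation L := (@lebesgue_measure R).
Local Notation Rp := (`[0, +oo[%classic : set R).

Lemma laplace_integrable_local (u X : R) (f : R -> R) : 0 < u ->
  laplace_integrable u f -> L.-integrable `[0, X] (EFin \o f).
Proof.
move=> u0 fL; have sub : `[0, X]%classic `<=` Rp.
  by move=> t /=; rewrite !in_itv/= andbT => /andP[].
have mf := measurable_funS (measurable_itv _) sub (laplace_integrable_measurable fL).
have bound : L.-integrable `[0, X] (fun t => (expR (X / u))%:E *
    (EFin \o (fun t => expR (- (t / u)) * f t)%R) t)%E.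
  by apply: integrableZl => //; apply: integrableS fL.
apply: le_integrable bound => //; first exact/measurable_EFinP.
move=> t /=; rewrite in_itv/= lee_fin => /andP[_ tX].
rewrite mulrA -expRD normrM ler_peMl// ger0_norm ?expR_ge0// -expR0 ler_expR.
by rewrite -mulrBl divr_ge0 ?subr_ge0// ltW.
Qed.

Lemma convol0 (f g : R -> R) : convol f g 0 = 0.
Proof. by rewrite /convol set_itv1 Rintegral_set1. Qed.

Variables (k alpha omega u : R).
Hypotheses (k0 : 0 < k) (alpha0 : 0 < alpha) (u0 : 0 < u).
Local Notation x := (omega * k * (u / k) `^ (alpha / k)).
Hypothesis x1 : `|x| < 1.

Lemma kPrabhakarE (a g : R) (f : R -> R) : 0 < a ->
  kPrabhakar k alpha a omega g f = convol (kPrabhakar_kernel k alpha a g omega) f.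
Proof. by move=> a0; apply/funext => t; rewrite /kPrabhakar (gt_eqF a0). Qed.

Lemma kPrabhakar0 (f : R -> R) : kPrabhakar k alpha 0 omega 0 f = f.
Proof. by apply/funext => t; rewrite /kPrabhakar eqxx. Qed.

Lemma laplace_kPrabhakar (a g : R) (f : R -> R) :
  0 < a \/ (a = 0 /\ g = 0) -> laplace_integrable u f ->
  laplace_integrable u (kPrabhakar k alpha a omega g f) /\
  laplace u (kPrabhakar k alpha a omega g f) =
    (u / k) `^ (a / k) * (1 - x) `^ (- (g / k)) * laplace u f.
Proof.
move=> [a0|[-> ->]] fL; last first.
  by rewrite kPrabhakar0 !mul0r oppr0 !powRr0 !mul1r.
have [KL Kl] := laplace_kPrabhakar_kernel g k0 alpha0 a0 u0 x1.
by rewrite kPrabhakarE// -Kl; exact: laplace_convol.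
Qed.

Section derivative.
Variables (b g : R) (G : R -> R).
Hypotheses (bg : 0 < b \/ (b = 0 /\ g = 0)) (acG : forall B, 0 < B -> AC0 B G).
Let G0 := lim (G t @[t --> 0^'+]).
Let D := kPrabhakar k alpha b omega g (derive1 G).

(* On ]0, X] the derivative of G is replaced under integrals by an integrable
   density phi; the interval ]0, X + 1[ is used for X not to be an end point. *)
Let density (X : R) : 0 < X -> exists phi : R -> R,
  [/\ L.-integrable setT (EFin \o phi),
      forall s (h : R -> R), 0 < s <= X ->
        \int[L]_(t in `[0, s]) (h t * derive1 G t) = \int[L]_(t in `[0, s]) (h t * phi t) &
      forall y, 0 < y <= X -> \int[L]_(t in `[0, y]) phi t = G y - G0].
Proof.
move=> X0; have X10 : 0 < X + 1 by rewrite ltr_wpDr.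
have [phi [N [phiL [mN N0] dG GE]]] := AC0_derivative X10 (acG X10).
have mset0 : measurable ([set 0] : set (measurableTypeR R)) by exact: measurable_set1.
have mN' : measurable (N `|` [set 0] : set (measurableTypeR R)) by exact: measurableU.
have N'0 : L (N `|` [set 0]) = 0%E.
  have : (L (N `|` [set 0%R]) <= L N + L [set 0%R])%E by exact: measureU2.
  by rewrite N0 add0e lebesgue_measure_set1 measure_le0 => /eqP.
exists phi; split => // [s h /andP[s0 sX]|y /andP[y0 yX]].
  apply: (Rintegral_off_null mN' N'0) => t /=; rewrite in_itv/= => /andP[t0 ts] nN.
  rewrite dG//; last by move=> Nt; apply: nN; left.
  rewrite (le_lt_trans (le_trans ts sX)) ?ltrDl// andbT lt_neqAle t0 andbT.
  by apply/eqP => t0'; apply: nN; right.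
by rewrite GE ?y0/= ?(le_trans yX) ?lerDl// -/G0 addrC addKr.
Qed.

(* Convolution with the constant 1 is integration from 0. *)
Let integral_D (X : R) : 0 < X ->
  convol (fun=> 1) D X =
  (if b == 0 then G X - G0
   else convol (fun y => G y - G0) (kPrabhakar_kernel k alpha b g omega) X).
Proof.
move=> X0; have [phi [phiL dG GE]] := density X0.
have phiX s : L.-integrable `[0, s] (EFin \o phi) by apply: integrableS phiL.
have -> : convol (fun=> 1) D X = \int[L]_(t in `[0, X]) D t.
  by apply: eq_Rintegral => t _; rewrite mul1r.
case: bg => [b0|[b0 g0]]; last first.
  rewrite b0 eqxx -GE ?X0 ?lexx// /D b0 g0 kPrabhakar0.
  have := dG X (fun=> 1); rewrite X0 lexx => /(_ isT).
  by under eq_Rintegral do rewrite mul1r; under [in RHS]eq_Rintegral do rewrite mul1r.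
rewrite (gt_eqF b0); set K := kPrabhakar_kernel _ _ _ _ _.
have [KL _] := laplace_kPrabhakar_kernel g k0 alpha0 b0 u0 x1.
have KX s : L.-integrable `[0, s] (EFin \o K) by exact: laplace_integrable_local KL.
transitivity (\int[L]_(s in `[0, X]) convol phi K s).
  apply: eq_Rintegral => s; rewrite inE/= in_itv/= => /andP[s0 sX].
  rewrite /D kPrabhakarE// -/K.
  move: s0; rewrite le_eqVlt => /predU1P[<-|s0]; first by rewrite !convol0.
  have -> : convol K (derive1 G) s = convol K phi s.
    by rewrite /convol (dG s (fun t => K (s - t)))// s0.
  by apply: convolC; apply/measurable_EFinP;
    [apply: measurable_int (KX s)|apply: measurable_int (phiX s)].
rewrite (convol_primitive (KX X) (phiX X)).
have mX : measurable ([set X] : set (measurableTypeR R)) by exact: measurable_set1.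
have LX : L [set X] = 0%E by exact: lebesgue_measure_set1.
apply: (Rintegral_off_null mX LX) => t /=; rewrite in_itv/= => /andP[t0 tX] ntX.
rewrite GE// gerBl t0 andbT subr_gt0 lt_neqAle tX andbT.
by apply/eqP => tX'; exact: ntX.
Qed.

(** The derivative of [G] itself need not have a Laplace integral at [u], so the
    convolution theorem is applied to the primitive of [D] instead. *)
Theorem laplace_kPrabhakar_derive1 :
  laplace_integrable u G -> laplace_integrable u D ->
  laplace u D = (u / k) `^ (b / k) * (1 - x) `^ (- (g / k)) * (laplace u G / u - G0).
Proof.
move=> GL DL; have [oneL onel] := laplace_cst1 u0.
have cL : laplace_integrable u (fun=> G0).
  have := @integrableZl _ _ _ L Rp (measurable_itv _) G0 _ oneL.
  by apply: eq_integrable => // t _ /=; rewrite -EFinM mulr1 mulrC.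
have HL : laplace_integrable u (fun y => G y - G0).
  have := @integrableB _ _ _ L Rp (measurable_itv _) _ _ GL cL.
  by apply: eq_integrable => // t _ /=; rewrite -EFinB mulrBr.
have cl : laplace u (fun=> G0) = G0 * u.
  transitivity (G0 * laplace u (fun=> 1)); last by rewrite onel.
  by rewrite /laplace -RintegralZl//; apply: eq_Rintegral => t _; ring.
have Hl : laplace u (fun y => G y - G0) = laplace u G - G0 * u.
  by rewrite -cl /laplace -RintegralB//; apply: eq_Rintegral => t _; ring.
have [_] := laplace_convol oneL DL; rewrite onel => uD.
suff -> : laplace u D =
    (u / k) `^ (b / k) * (1 - x) `^ (- (g / k)) * laplace u (fun y => G y - G0) / u.
  by rewrite Hl; field; exact: lt0r_neq0.
apply: (mulfI (lt0r_neq0 u0)); rewrite -uD mulrC divfK ?lt0r_neq0//.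
have mset0 : measurable ([set 0] : set (measurableTypeR R)) by exact: measurable_set1.
have null0 : L [set 0] = 0%E by exact: lebesgue_measure_set1.
case: bg => [b0|[b0 g0]].
  have [KL Kl] := laplace_kPrabhakar_kernel g k0 alpha0 b0 u0 x1.
  rewrite -Kl mulrC -(laplace_convol HL KL).2; apply: eq_Rintegral => t.
  rewrite inE/= in_itv/= andbT le_eqVlt => /predU1P[<-|t0]; first by rewrite !convol0.
  by rewrite integral_D// (gt_eqF b0).
rewrite b0 g0 !mul0r oppr0 !powRr0 !mul1r.
apply: (Rintegral_off_null mset0 null0) => t /=.
rewrite in_itv/= andbT le_eqVlt => /predU1P[<-//|t0 _].
by rewrite integral_D// b0 eqxx.
Qed.

End derivative.
End kPrabhakar_laplace.

Section sumudu_laplace.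
Context {R : realType}.
Local Notation L := (@lebesgue_measure R).
Local Notation Rp := (`[0, +oo[%classic : set R).

(** The constant [c] is the factor [k] of the derivative, or 1. *)
Lemma ex_sumudu_laplace (c u : R) (f : R -> R) : c != 0 -> 0 < u ->
  ex_sumudu (fun t => c * f t) u -> laplace_integrable u f.
Proof.
move=> c0 u0 fS.
have := @integrableZl _ _ _ L Rp (measurable_itv _) (u / c) _ fS.
apply: eq_integrable => // t _ /=; rewrite -EFinM; congr (_%:E).
by field; rewrite c0 lt0r_neq0.
Qed.

Lemma sumudu_laplace (c u : R) (f : R -> R) : laplace_integrable u f ->
  sumudu (fun t => c * f t) u = u^-1 * c * laplace u f.
Proof.
move=> fL; rewrite /laplace -RintegralZl//; apply: eq_Rintegral => t _.
by ring.
Qed.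

End sumudu_laplace.

(** * The Sumudu transform of the k-Hilfer-Prabhakar derivative *)

Theorem lemma3p8 (R : realType) (k alpha gam omega mu nu : R) (f : R -> R)
  (hk : 0 < k) (halpha : 0 < alpha) (hmu : 0 < mu < 1) (hmuk : mu < k)
  (hnu : 0 <= nu <= 1)
  (hf : forall b : R, 0 < b ->
     (@lebesgue_measure R).-integrable `[0, b] (EFin \o f))
  (hAC : forall b : R, 0 < b ->
     AC0 b (kPrabhakar k alpha ((1 - nu) * (k - mu)) omega
              (- (gam * (1 - nu))) f))
  (u : R) (hu : 0 < u)
  (hSf : ex_sumudu f u)
  (hSD : ex_sumudu (kHilferPrabhakar k alpha omega gam mu nu f) u)
  (hconv : `|omega * k * (u / k) `^ (alpha / k)| < 1) :
  sumudu (kHilferPrabhakar k alpha omega gam mu nu f) u =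
    (u / k) `^ (- (mu / k))
      * (1 - omega * k * (u / k) `^ (alpha / k)) `^ (gam / k) * sumudu f u
    - (u / k) `^ (nu * (k - mu) / k - 1)
      * (1 - omega * k * (u / k) `^ (alpha / k)) `^ (gam * nu / k)
      * lim (kPrabhakar k alpha ((1 - nu) * (k - mu)) omega
               (- (gam * (1 - nu))) f t @[t --> 0^'+]).
Proof.
have /andP[mu0 _] := hmu; have /andP[nu0 nu1] := hnu.
set a := (1 - nu) * (k - mu); set ga := - (gam * (1 - nu)).
set b := nu * (k - mu); set x := omega * k * _.
set G := kPrabhakar k alpha a omega ga f.
(* At nu = 1, respectively nu = 0, the inner, respectively outer, operator is
   the identity; otherwise its order is positive. *)
have kmu : 0 < k - mu by rewrite subr_gt0.
have aP : 0 < a \/ (a = 0 /\ ga = 0).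
  have [nu_lt1|nu_ge1] := ltP nu 1; first by left; rewrite mulr_gt0// subr_gt0.
  have nuE : nu = 1 by apply/eqP; rewrite eq_le nu1.
  by right; rewrite /a /ga nuE subrr mul0r mulr0 oppr0.
have bP : 0 < b \/ (b = 0 /\ - (gam * nu) = 0).
  move: nu0; rewrite le_eqVlt => /predU1P[nu0|nu0]; last by left; rewrite mulr_gt0.
  by right; rewrite /b -nu0 mul0r mulr0 oppr0.
have fL : laplace_integrable u f.
  apply: (@ex_sumudu_laplace _ 1) => //.
  rewrite (_ : (fun t => _) = f)//; by apply/funext => t; rewrite mul1r.
have [GL Gl] := laplace_kPrabhakar hk halpha hu hconv aP fL.
have DL := ex_sumudu_laplace (lt0r_neq0 hk) hu hSD.
have Dl := laplace_kPrabhakar_derive1 hk halpha hu hconv bP hAC GL DL.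
rewrite [LHS](sumudu_laplace _ DL) Dl Gl -/x -/a -/ga -/G.
have -> : sumudu f u = u^-1 * laplace u f.
  rewrite -[u^-1]mulr1 -sumudu_laplace//; congr (sumudu _ u).
  by apply/funext => t; rewrite mul1r.
have uk0 : 0 < u / k by rewrite divr_gt0.
have x0 : 0 < 1 - x by move: hconv; rewrite -/x ltr_norml subr_gt0 => /andP[].
have powk p q : (u / k) `^ (p + q) = (u / k) `^ p * (u / k) `^ q.
  by rewrite powRD// (gt_eqF uk0) implybT.
have -> : (u / k) `^ (- (mu / k)) = (u / k) `^ (b / k) * (u / k) `^ (a / k) * (u / k)^-1.
  rewrite -[(u / k)^-1]powR_inv1 ?(ltW uk0)// -!powk; congr (_ `^ _).
  by rewrite /a /b; field; exact: lt0r_neq0.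
have -> : (u / k) `^ (b / k - 1) = (u / k) `^ (b / k) * (u / k)^-1.
  by rewrite powk powR_inv1// ltW.
have -> : (1 - x) `^ (gam / k) = (1 - x) `^ (- (- (gam * nu) / k)) * (1 - x) `^ (- (ga / k)).
  rewrite -powRD ?(gt_eqF x0) ?implybT//; congr (_ `^ _).
  by rewrite /ga; field; exact: lt0r_neq0.
have -> : - (- (gam * nu) / k) = gam * nu / k by rewrite mulNr opprK.
by field; rewrite !lt0r_neq0.
Qed.
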